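(* Suppose Assumptions 1 and 2 (stated in the context) hold. If $K\in\mathcal{K}_\beta$ is a stationary point of $J_{\mathrm{mix}}$, i.e. $\nabla J_{\mathrm{mix}}(K)=0$, then $K$ is a global minimizer of $J_{\mathrm{mix}}$ over $\mathcal{K}_\beta$, i.e. $J_{\mathrm{mix}}(K)=\inf_{K'\in\mathcal{K}_\beta}J_{\mathrm{mix}}(K')$.
   Context: Let $A\in\mathbb{R}^{n\times n}$, $B\in\mathbb{R}^{n\times m}$, $B_w\in\mathbb{R}^{n\times n}$, $W:=B_wB_w^{\mathsf T}$. Let $Q_2\succeq0$, $R_2\succ0$, $Q_\infty\succ0$, $R_\infty\succ0$ be symmetric weight matrices of appropriate sizes and let $\beta>0$. For $K\in\mathbb{R}^{m\times n}$ write $A_K:=A+BK$ and $S_K:=Q_\infty+K^{\mathsf T}R_\infty K$. Let $\mathcal{K}:=\{K\in\mathbb{R}^{m\times n}: A_K \text{ is Hurwitz}\}$. For $K\in\mathcal{K}$ let $\mathbf{T}_\infty(K)(s)=\begin{bmatrix}Q_\infty^{1/2}\\ R_\infty^{1/2}K\end{bmatrix}(sI-A_K)^{-1}B_w$, and let $\|\cdot\|_{\mathcal{H}_\infty}$ denote the $\mathcal{H}_\infty$ norm. Define $\mathcal{K}_\beta:=\{K\in\mathcal{K}:\|\mathbf{T}_\infty(K)\|_{\mathcal{H}_\infty}<\beta\}$ (an open set). For $K\in\mathcal{K}_\beta$, the Riccati equation $A_KX+XA_K^{\mathsf T}+\beta^{-2}XS_KX+W=0$ has a unique stabilizing solution $X_K$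 (i.e. $A_K+\beta^{-2}X_KS_K$ is Hurwitz), and $X_K\succeq0$. The mixed $\mathcal{H}_2/\mathcal{H}_\infty$ cost is $J_{\mathrm{mix}}(K):=\operatorname{tr}((Q_2+K^{\mathsf T}R_2K)X_K)$ for $K\in\mathcal{K}_\beta$; it is differentiable on $\mathcal{K}_\beta$. Assumption 1: $(A,B)$ is stabilizable, $(Q_2^{1/2},A)$ is detectable, and $\beta>\beta^\ast:=\inf_{K\in\mathcal{K}}\|\mathbf{T}_\infty(K)\|_{\mathcal{H}_\infty}$. Assumption 2: $Q_2\succeq0$, and $W$, $Q_\infty$, $R_2$, $R_\infty$ are positive definite. *)

(* Defs.v *)
From mathcomp Require Import all_boot all_order all_algebra.
From mathcomp Require Import all_classical all_reals all_analysis.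
From mathcomp Require Import complex.
Import numFieldNormedType.Exports.
Import Order.TTheory GRing.Theory Num.Theory.

Set Implicit Arguments.
Unset Strict Implicit.
Unset Printing Implicit Defensive.

Local Open Scope ring_scope.

Section MixedH2Hinf.
Variable R : realType.

Definition cmx (p q : nat) (M : 'M[R]_(p, q)) : 'M[R[i]]_(p, q) :=
  map_mx (real_complex R) M.

Definition hurwitz (k : nat) (M : 'M[R]_k) : Prop :=
  forall l : R[i], eigenvalue (cmx M) l -> complex.Re l < 0.

Definition symmetric (k : nat) (M : 'M[R]_k) : Prop := M^T = M.

Definition psd (k : nat) (M : 'M[R]_k) : Prop :=
  symmetric M /\ forall x : 'cV[R]_k, 0 <= (x^T *m M *m x) 0 0.

Definition pd (k : nat) (M : 'M[R]_k) : Prop :=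
  symmetric M /\ forall x : 'cV[R]_k, x != 0 -> 0 < (x^T *m M *m x) 0 0.

Definition is_psd_sqrt (k : nat) (M S : 'M[R]_k) : Prop :=
  psd S /\ S *m S = M.

Definition stabilizable (k p : nat) (A : 'M[R]_k) (B : 'M[R]_(k, p)) : Prop :=
  exists K : 'M[R]_(p, k), hurwitz (A + B *m K).

Definition detectable (k p : nat) (C : 'M[R]_(p, k)) (A : 'M[R]_k) : Prop :=
  exists L : 'M[R]_(k, p), hurwitz (A + L *m C).

Definition cnorm2 (p : nat) (v : 'cV[R[i]]_p) : R :=
  \sum_(i < p) (complex.Re (v i 0) ^+ 2 + complex.Im (v i 0) ^+ 2).

Definition freq_resp (p q k : nat) (C : 'M[R]_(p, k)) (A : 'M[R]_k)
    (B : 'M[R]_(k, q)) (w : R) : 'M[R[i]]_(p, q) :=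
  cmx C *m invmx ((w *i)%C%:M - cmx A) *m cmx B.

(* H-infinity norm: sup over real frequencies w of the largest singular
   value (induced 2-norm) of the frequency response at j w *)
Definition hinf_norm (p q k : nat) (C : 'M[R]_(p, k)) (A : 'M[R]_k)
    (B : 'M[R]_(k, q)) : R :=
  Num.sqrt (sup [set r : R | exists (w : R) (v : 'cV[R[i]]_q),
      v != 0 /\ r = cnorm2 (freq_resp C A B w *m v) / cnorm2 v]).

Variables (n m : nat).
Variables (A : 'M[R]_n) (B : 'M[R]_(n, m)) (Bw : 'M[R]_n).
Variables (Q2 : 'M[R]_n) (R2 : 'M[R]_m) (Qinf : 'M[R]_n) (Rinf : 'M[R]_m).
(* Qinfh = Qinf^{1/2}, Rinfh = Rinf^{1/2} *)
Variables (Qinfh : 'M[R]_n) (Rinfh : 'M[R]_m).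
Variable beta : R.

Definition Wmx : 'M[R]_n := Bw *m Bw^T.
Definition AK (K : 'M[R]_(m, n)) : 'M[R]_n := A + B *m K.
Definition SK (K : 'M[R]_(m, n)) : 'M[R]_n := Qinf + K^T *m Rinf *m K.

Definition Tinf_norm (K : 'M[R]_(m, n)) : R :=
  hinf_norm (col_mx Qinfh (Rinfh *m K)) (AK K) Bw.

Definition Kstab : set 'M[R]_(m, n) := [set K | hurwitz (AK K)].

Definition Kbeta : set 'M[R]_(m, n) :=
  [set K | hurwitz (AK K) /\ Tinf_norm K < beta].

Definition beta_star : R := inf [set Tinf_norm K | K in Kstab].

Definition stab_riccati (K : 'M[R]_(m, n)) (X : 'M[R]_n) : Prop :=
  AK K *m X + X *m (AK K)^T + beta ^- 2 *: (X *m SK K *m X) + Wmx = 0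
  /\ hurwitz (AK K + beta ^- 2 *: (X *m SK K)).

(* X_K : the (unique, for K in Kbeta) stabilizing solution *)
Definition XK (K : 'M[R]_(m, n)) : 'M[R]_n := xget 0 [set X | stab_riccati K X].

Definition Jmix (K : 'M[R]_(m, n)) : R := \tr ((Q2 + K^T *m R2 *m K) *m XK K).

End MixedH2Hinf.

(* Main.v *)
(* With [Y = K X], the cost [tr (Q2 X + R2 Y X^-1 Y^T)] and the Riccati
   inequality [A X + X A^T + B Y + Y^T B^T + beta^-2 (X Qinf X + Y^T Rinf Y) + W <= 0]
   are jointly convex in [(X, Y)].  Moving linearly from [(X_K, K X_K)] to
   [(X_K', K' X_K')] yields gains [K_t = Y_t X_t^-1] with [X_{K_t} <= X_t], hence
   [J K_t <= (1 - t) J K + t J K'].  As [`|K_t - K| = O(t)], a vanishing derivative at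
   [K] excludes [J K' < J K].  The stabilizing solution for a gain with H-infinity norm
   below [beta] comes from the stable invariant subspace of the Hamiltonian matrix,
   which has no eigenvalue on the imaginary axis; that subspace is Lagrangian, and a
   graph because [SK] is definite. *)

Require Import Defs.
From mathcomp Require Import all_boot all_order all_algebra.
From mathcomp Require Import all_classical all_reals all_analysis.
From mathcomp Require Import complex.
From mathcomp Require Import ring lra zify.
Import numFieldNormedType.Exports.
Import Order.TTheory GRing.Theory Num.Theory.
Local Open Scope ring_scope.
Local Open Scope classical_set_scope.

(** Returning from [(X, Y)] to a gain divides by [X], so [X_K] has to be definite; [riccati_pd]
    extracts this from the definiteness of [W]. Both this positivity and the order [X_{K_t} <= X_t]
    rest on one fact: a symmetric matrix with a semidefinite Lyapunov residual for a Hurwitz matrix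
    is semidefinite. The proof of that fact is algebraic, by unitary triangularization and Schur
    complements, in place of an integral of matrix exponentials. Uniqueness of stabilizing solutions
    is algebraic too: it reduces to Sylvester equations with disjoint spectra. The gains [K_t] are
    not shown to stay in [Kbeta]: [XK] is total, and the bound on [J K_t] is proved for whichever
    value [XK] takes there. Since [eigenvalue] refers to left eigenvectors, subspaces are row spaces
    and the Hamiltonian matrix is the transpose of the usual one. *)

Lemma addmxE (V : nmodType) m n (M N : 'M[V]_(m, n)) i j : (M + N) i j = M i j + N i j.
Proof. by rewrite mxE. Qed.

Lemma oppmxE (V : zmodType) m n (M : 'M[V]_(m, n)) i j : (- M) i j = - M i j.
Proof. by rewrite mxE. Qed.

Lemma scalemxE (S : pzRingType) m n a (M : 'M[S]_(m, n)) i j : (a *: M) i j = a * M i j.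
Proof. by rewrite mxE. Qed.

Lemma ulsubmx_scalar (S : pzRingType) n (M : 'M[S]_(1 + n)) : ulsubmx M = (M 0 0)%:M.
Proof.
by apply/matrixP => i j; rewrite !ord1 !mxE mulr1n; congr (M _ _); exact/val_inj.
Qed.

(** * Semidefinite Hermitian forms and Schur complements *)

Section HermitianForms.
Variable C : numClosedFieldType.
Local Notation "M ^h" := (map_mx (@Num.conj C) M^T) (at level 2, format "M ^h").

Definition psdC n (N : 'M[C]_n) := forall x : 'rV[C]_n, 0 <= (x *m N *m x^h) 0 0.

Lemma ctmxK m n (M : 'M[C]_(m, n)) : M^h^h = M.
Proof. by apply/matrixP => i j; rewrite !mxE conjCK. Qed.

Lemma ctmxM m n p (M : 'M[C]_(m, n)) (N : 'M[C]_(n, p)) : (M *m N)^h = N^h *m M^h.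
Proof. by rewrite trmx_mul map_mxM. Qed.

Lemma ctmxD m n (M N : 'M[C]_(m, n)) : (M + N)^h = M^h + N^h.
Proof. by rewrite linearD /= map_mxD. Qed.

Lemma ctmxN m n (M : 'M[C]_(m, n)) : (- M)^h = - M^h.
Proof. by rewrite linearN /= map_mxN. Qed.

Lemma ctmxZ m n a (M : 'M[C]_(m, n)) : (a *: M)^h = a^* *: M^h.
Proof. by rewrite linearZ /= map_mxZ. Qed.

Lemma dot_ge0 n (u : 'rV[C]_n) : 0 <= (u *m u^h) 0 0.
Proof. by rewrite mxE sumr_ge0// => i _; rewrite !mxE mul_conjC_ge0. Qed.

Lemma dot_eq0 n (u : 'rV[C]_n) : (u *m u^h) 0 0 = 0 -> u = 0.
Proof.
rewrite mxE => /eqP; rewrite psumr_eq0 => [/allP u0|i _]; last first.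
  by rewrite !mxE mul_conjC_ge0.
apply/rowP => i; rewrite mxE; apply/eqP; rewrite -mul_conjC_eq0.
by have := u0 i (mem_index_enum i); rewrite !mxE.
Qed.

(** With [u = v N] and [a = |u|^2], the form at [v - s u] equals [- 2 s a + s^2 c], which is
    negative for small [s > 0] unless [a = 0]. *)
Lemma psdC_ker n (N : 'M[C]_n) (v : 'rV[C]_n) :
  N^h = N -> psdC n N -> (v *m N *m v^h) 0 0 = 0 -> v *m N = 0.
Proof.
move=> hN pN v0; apply: dot_eq0; set u := v *m N; set a := (_ *m _) 0 0.
have a0 : 0 <= a by apply: dot_ge0.
apply/eqP/contraT => an0; have {}a0 : 0 < a by rewrite lt_def an0.
set c := (u *m N *m u^h) 0 0; have c0 : 0 <= c by apply: pN.
(* This [s] satisfies [s c = a - s], so the form collapses to [- s (a + s)]; the [+ 1] covers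
   [c = 0]. *)
pose s := a / (c + 1); have c1 : 0 < c + 1 by rewrite ltr_wpDl.
have s0 : 0 < s by rewrite divr_gt0.
have := pN (v + - s *: u).
have uh : u *m N *m v^h = u *m u^h by rewrite -mulmxA; congr (_ *m _); rewrite /u ctmxM hN.
have sr : (- s)^* = - s by apply: CrealP; rewrite realN realE (ltW s0).
rewrite ctmxD ctmxZ sr !mulmxDl !mulmxDr -!scalemxAl -!scalemxAr -/u uh scalerA mulrNN.
rewrite !addmxE !scalemxE v0 -/a -/c add0r.
have -> : - s * a + (- s * a + s * s * c) = - (s * (a + s)).
  rewrite /s; field; exact: lt0r_neq0.
by rewrite oppr_ge0 => /(lt_le_trans _) => /(_ 0); rewrite ltxx mulr_gt0 ?addr_gt0// => /(_ isT).
Qed.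

Section SchurComplement.
Variables (n : nat) (N : 'M[C]_(1 + n)).
Hypothesis hN : N^h = N.
Let p := N 0 0.
Let q := dlsubmx N.
Hypothesis pq : p = 0 -> q = 0.
(** Its rows are [N]-orthogonal to the first basis vector. When [p = 0], the convention [0^-1 = 0]
    and the hypothesis [pq] keep the formulas valid. *)
Definition schur_row := row_mx (- (p^-1 *: q)) (1%:M : 'M[C]_n).
Definition schur_compl := drsubmx N - p^-1 *: (q *m q^h).

Let ursub : ursubmx N = q^h.
Proof. by apply/matrixP => i j; rewrite !mxE -{1}hN !mxE. Qed.

Let ulsub : ulsubmx N = p%:M. Proof. exact: ulsubmx_scalar. Qed.

Let pr : p^* = p. Proof. by rewrite /p -{2}hN !mxE. Qed.

Lemma schur_rowM : schur_row *m N = row_mx 0 schur_compl.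
Proof.
rewrite -{1}[N]submxK mul_row_block mul1mx mul1mx ulsub ursub -/q.
rewrite mul_mx_scalar scalerN scalerA mulNmx -scalemxAl addrC -/schur_compl.
congr row_mx; last by rewrite addrC.
have [p0|p0] := eqVneq p 0; first by rewrite pq// scaler0 subr0.
by rewrite mulfV// scale1r subrr.
Qed.

Lemma schur_compl_herm : schur_compl^h = schur_compl.
Proof.
rewrite /schur_compl -scaleNr ctmxD ctmxZ ctmxM ctmxK; congr (_ + _ *: _).
  by apply/matrixP => i j; rewrite !mxE -{2}hN !mxE.
by rewrite rmorphN fmorphV /= pr.
Qed.

(** Completing the square in the first coordinate: [x] splits into a multiple [a] of the first basis
    vector and a combination of the rows of [schur_row], and the cross terms vanish. *)
Lemma schur_form (x : 'rV[C]_(1 + n)) :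
  let a := x 0 0 + p^-1 * (rsubmx x *m q) 0 0 in
  (x *m N *m x^h) 0 0 = p * (a * a^*) +
    (rsubmx x *m schur_compl *m (rsubmx x)^h) 0 0.
Proof.
move=> a; set y := rsubmx x.
have xE : x = row_mx a%:M 0 + y *m schur_row.
  rewrite -{1}[x]hsubmxK /schur_row mul_mx_row mulmx1 add_row_mx add0r.
  congr row_mx; apply/matrixP => i j; rewrite !ord1 mulmxN -scalemxAr.
  rewrite addmxE oppmxE scalemxE [a%:M _ _]mxE eqxx mulr1n /a addrK mxE.
  by congr (x _ _); apply/val_inj.
have cross (M : 'M[C]_(1, n)) : row_mx 0 M *m (row_mx a%:M 0)^h = 0.
  by rewrite tr_row_mx map_col_mx !linear0 map_mx0 mul_row_col mul0mx mulmx0 addr0.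
rewrite {1 2}xE ctmxD !mulmxDl !mulmxDr.
have -> : y *m schur_row *m N = row_mx 0 (y *m schur_compl).
  by rewrite -mulmxA schur_rowM mul_mx_row mulmx0.
have -> : row_mx a%:M 0 *m N *m (y *m schur_row)^h = 0.
  rewrite -[N in LHS]hN -mulmxA -ctmxM -mulmxA schur_rowM mul_mx_row mulmx0.
  by rewrite -[LHS]ctmxK ctmxM ctmxK cross trmx0 map_mx0.
rewrite cross addr0 add0r addmxE; congr (_ + _).
  rewrite -{1}[N]submxK mul_row_block !mul0mx !addr0 ulsub.
  rewrite tr_row_mx map_col_mx mul_row_col !linear0 map_mx0 mulmx0 addr0.
  rewrite tr_scalar_mx map_scalar_mx -!scalar_mxM mxE eqxx mulr1n; ring.
congr (fun_of_matrix _ 0 0); rewrite ctmxM mulmxA; congr (_ *m _).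
rewrite /schur_row tr_row_mx map_col_mx mul_row_col mul0mx add0r.
by rewrite trmx1 map_mx1 mulmx1 -mulmxDr.
Qed.
End SchurComplement.

Lemma psdC_diag n (N : 'M[C]_n) i : psdC n N -> 0 <= N i i.
Proof.
move=> /(_ (delta_mx 0 i)).
by rewrite -rowE trmx_delta map_delta_mx -colE !mxE.
Qed.

Lemma psdC00 n (N : 'M[C]_(1 + n)) : N^h = N -> psdC _ N -> N 0 0 = 0 ->
  dlsubmx N = 0.
Proof.
move=> hN pN N0; have /rowP r0 : row 0 N = 0.
  rewrite rowE; apply: psdC_ker => //.
  by rewrite -rowE trmx_delta map_delta_mx -colE !mxE.
apply/matrixP => i j; have := r0 (rshift 1 i); rewrite [in X in X -> _]mxE [RHS]mxE => N0i.
have l0 : lshift n j = 0 by apply/val_inj; rewrite ord1.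
by rewrite -{1}hN 4!mxE l0 N0i mxE conjC0.
Qed.

(* Induction on the size: the Schur complement of [P 0 0] solves the Lyapunov
   inequality of the trailing block of [T]. *)
Lemma lyapunov_trig n (T P : 'M[C]_n) : is_trig_mx T ->
  (forall i, T i i + (T i i)^* < 0) -> P^h = P ->
  psdC n (- (T *m P + P *m T^h)) -> psdC n P.
Proof.
elim: n T P => [|n IH] T P; first by move=> _ _ _ _ x; rewrite thinmx0 mul0mx mxE.
rewrite -[n.+1]/(1 + n)%N in T P *.
move=> trT ReT hP; set N := (X in psdC _ X -> _); move=> pN.
have hN : N^h = N by rewrite /N ctmxN ctmxD !ctmxM ctmxK hP addrC.
have /and3P[/eqP Tur _ trT1] :
    [&& ursubmx T == 0, is_trig_mx (ulsubmx T) & is_trig_mx (drsubmx T)].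
  by rewrite -(is_trig_block_mx _ _ (dlsubmx T))// submxK.
have Tdd i : (drsubmx T) i i + ((drsubmx T) i i)^* < 0 by rewrite !mxE; apply: ReT.
have T00 := ReT 0.
have Tul := ulsubmx_scalar _ _ T; have Pul := ulsubmx_scalar _ _ P.
have N00 : N 0 0 = - (T 0 0 + (T 0 0)^*) * P 0 0.
  have -> : N 0 0 = (ulsubmx N) 0 0 by rewrite ulsubmx_scalar [RHS]mxE mulr1n.
  rewrite /N -[T in LHS]submxK -[P in LHS]submxK tr_block_mx map_block_mx !mulmx_block.
  rewrite add_block_mx opp_block_mx block_mxKul Tur trmx0 map_mx0 mulmx0 mul0mx.
  by rewrite Tul Pul tr_scalar_mx map_scalar_mx -!scalar_mxM oppmxE addmxE !mxE !mulr1n; ring.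
have p0 : 0 <= P 0 0.
  by have := psdC_diag _ _ 0 pN; rewrite N00 pmulr_rge0// oppr_gt0.
(* If [P 0 0 = 0] then [N 0 0 = 0], so the first column of [N] vanishes. Its lower part says that
   [drsubmx T + (T 0 0)^*] annihilates [dlsubmx P], and this triangular matrix is invertible because
   its diagonal has negative real parts. *)
have pq : P 0 0 = 0 -> dlsubmx P = 0.
  move=> P0; have := psdC00 _ _ hN pN; rewrite N00 P0 mulr0 => /(_ erefl).
  rewrite /N -[T in LHS]submxK -[P in LHS]submxK tr_block_mx map_block_mx !mulmx_block.
  rewrite add_block_mx opp_block_mx block_mxKdl Tur trmx0 map_mx0 !mulmx0.
  rewrite Tul Pul P0 raddf0 mulmx0 add0r addr0 tr_scalar_mx map_scalar_mx => /eqP.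
  rewrite oppr_eq0 mul_mx_scalar -mul_scalar_mx -mulmxDl => /eqP TP.
  have Tu : drsubmx T + ((T 0 0)^*)%:M \in unitmx.
    rewrite unitmxE unitfE det_trig.
      apply/prodf_neq0 => i _; apply/eqP; rewrite addmxE [_%:M _ _]mxE eqxx mulr1n => E.
      have := Tdd i; set a := drsubmx T i i in E *; set b := T 0 0 in E T00 => a0.
      have : a + a^* + (b + b^*) < 0 by rewrite -[ltRHS]addr0 ltrD.
      suff -> : a + a^* + (b + b^*) = (a + b^*) + (a + b^*)^* by rewrite E conjC0 addr0 ltxx.
      rewrite rmorphD /= conjCK; ring.
    apply/is_trig_mxP => i j ij; move/is_trig_mxP: trT1 => /(_ i j ij) Tij.
    by rewrite addmxE Tij [_%:M _ _]mxE -val_eqE /= ltn_eqF// addr0.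
  by rewrite -[LHS](mulKmx Tu) TP mulmx0.
have Q : psdC n (schur_compl n P).
  apply: (IH (drsubmx T)) => //; first exact: schur_compl_herm.
  (* Since [T] is lower triangular, the right block of [g *m T] is [drsubmx T]; its unknown left
     block meets the zero block of [g *m P]. So congruence by [g] turns [N] into the Lyapunov
     residual of the Schur complement. *)
  move=> x; have := pN (x *m schur_row n P).
  set g := schur_row n P.
  have gP : g *m P = row_mx 0 (schur_compl n P) by exact: schur_rowM.
  have gT : g *m T = row_mx (lsubmx (g *m T)) (drsubmx T).
    rewrite -[LHS]hsubmxK; congr row_mx.
    by rewrite -[T in LHS]submxK mul_row_block row_mxKr Tur mulmx0 add0r mul1mx.
  have gN : g *m N *m g^h = - (drsubmx T *m schur_compl n P + schur_compl n P *m (drsubmx T)^h).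
    have E : g *m T *m (g *m P)^h = drsubmx T *m schur_compl n P.
      rewrite gP gT tr_row_mx map_col_mx mul_row_col trmx0 map_mx0 mulmx0 add0r.
      by rewrite schur_compl_herm.
    rewrite /N mulmxN mulNmx mulmxDr mulmxDl; congr (- (_ + _)).
      by rewrite -E ctmxM hP !mulmxA.
    by rewrite -[schur_compl n P in RHS](schur_compl_herm _ _ hP) -ctmxM -E !ctmxM !ctmxK !mulmxA.
  have -> : x *m g *m N *m (x *m g)^h = x *m (g *m N *m g^h) *m x^h.
    by rewrite ctmxM !mulmxA.
  by rewrite gN.
move=> x; rewrite (schur_form _ _ hP pq) addr_ge0// mulr_ge0//; exact: mul_conjC_ge0.
Qed.

End HermitianForms.

(** * Lyapunov and Sylvester equations *)

Section HermitianLyapunov.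
Variable C : numClosedFieldType.
Local Notation "M ^h" := (map_mx (@Num.conj C) M^T) (at level 2, format "M ^h").

Lemma psdC_congr m n (N : 'M[C]_n) (U : 'M[C]_(m, n)) :
  psdC C n N -> psdC C m (U *m N *m U^h).
Proof.
by move=> pN x; have := pN (x *m U); rewrite ctmxM !mulmxA.
Qed.

(** Unitary triangularization turns the residual into a congruent one and puts the eigenvalues of
    [M] on the diagonal. *)
Lemma lyapunov n (M P : 'M[C]_n) : (forall l, eigenvalue M l -> l + l^* < 0) ->
  P^h = P -> psdC C n (- (M *m P + P *m M^h)) -> psdC C n P.
Proof.
case: n M P => [|n] M P eM hP pN; first by move=> x; rewrite thinmx0 mul0mx mxE.
have [U uU tr] := Schur M (ltn0Sn n).
have UU : U^h *m U = 1%:M by apply/mulmx1C/eqP.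
set T := U *m M *m U^h.
have TE : is_trig_mx T by move: tr; rewrite /similar_to conjymx.
have -> : P = U^h *m (U *m P *m U^h) *m (U^h)^h.
  by rewrite ctmxK !mulmxA UU mul1mx -mulmxA UU mulmx1.
apply: psdC_congr; apply: (lyapunov_trig _ _ T) => //.
- move=> i; apply: eM; have : eigenvalue T (T i i).
    rewrite eigenvalue_root_char char_poly_trig// rootE horner_prod.
    by rewrite (bigD1 i)//= hornerXsubC subrr mul0r.
  move=> /eigenvalueP[v vT v0]; apply/eigenvalueP; exists (v *m U).
    by rewrite scalemxAl -vT /T !mulmxA -[RHS]mulmxA UU mulmx1.
  apply: contra_neq v0 => vU; have : v *m U *m U^h = 0 by rewrite vU mul0mx.
  by rewrite -mulmxA (unitarymxP uU) mulmx1.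
- by rewrite !ctmxM ctmxK hP mulmxA.
- have -> : - (T *m (U *m P *m U^h) + U *m P *m U^h *m T^h) =
     U *m (- (M *m P + P *m M^h)) *m U^h.
    rewrite mulmxN mulNmx mulmxDr mulmxDl; congr (- (_ + _)).
      by rewrite /T !mulmxA -[_ *m U^h *m U]mulmxA UU mulmx1.
    by rewrite /T !ctmxM ctmxK !mulmxA -[_ *m U^h *m U]mulmxA UU mulmx1.
  exact: psdC_congr.
Qed.

(** In an orthonormal eigenbasis of [P] the trace is a sum of eigenvalues of [P] times diagonal
    entries of a matrix congruent to [Q]. *)
Lemma psdC_tr n (P Q : 'M[C]_n) : P^h = P -> psdC C n P -> psdC C n Q -> 0 <= \tr (P *m Q).
Proof.
move=> hP pP pQ.
have /orthomx_spectralP : P \is normalmx by apply/normalmxP; rewrite hP.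
set U := spectralmx P => PE; have uU : U \is unitarymx by exact: spectral_unitarymx.
have UU : U *m U^h = 1%:M by apply/eqP.
have DE : diag_mx (spectral_diag P) = U *m P *m U^h.
  by rewrite {2}PE (invmx_unitary uU) !mulmxA UU mul1mx -!mulmxA UU mulmx1.
rewrite PE (invmx_unitary uU) -!mulmxA mxtrace_mulC -!mulmxA.
rewrite mul_diag_mx; apply: sumr_ge0 => i _; rewrite mxE mulr_ge0//.
  have := psdC_diag _ _ _ i (psdC_congr _ _ _ U pP).
  by rewrite -DE mxE eqxx mulr1n.
by rewrite mulmxA; apply/psdC_diag/psdC_congr.
Qed.

(** [Y] intertwines [p(M)] and [p(N)] for every polynomial [p]. For [p] the characteristic
    polynomial of [M], [p(M)] vanishes while [p(N)] is invertible by a Bezout relation. *)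
Lemma sylvester0 m n (M : 'M[C]_m) (N : 'M[C]_n) (Y : 'M[C]_(m, n)) :
  (forall l, eigenvalue M l -> ~~ eigenvalue N l) -> M *m Y = Y *m N -> Y = 0.
Proof.
case: m M Y => [|m] M Y; first by rewrite [Y]flatmx0.
case: n N Y => [|n] N Y; first by rewrite [Y]thinmx0.
move=> dis MY.
have pY p : horner_mx M p *m Y = Y *m horner_mx N p.
  elim/poly_ind: p => [|p c IH]; first by rewrite !rmorph0 mul0mx mulmx0.
  rewrite !rmorphD !rmorphM /= !horner_mx_X !horner_mx_C mulmxDl mulmxDr.
  congr (_ + _); last by rewrite scalar_mxC.
  by rewrite -[_ * M]/(_ *m M) -[_ * N]/(_ *m N) -[LHS]mulmxA MY [LHS]mulmxA IH mulmxA.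
have /Bezout_eq1_coprimepP[[u v] /= uv] : coprimep (char_poly M) (char_poly N).
  apply: Pdiv.ClosedField.root_coprimep => x; rewrite -eigenvalue_root_char => /dis.
  by rewrite eigenvalue_root_char.
have := pY (char_poly M); rewrite Cayley_Hamilton mul0mx.
move=> /(congr1 (fun Z => Z *m horner_mx N u)); rewrite mul0mx -mulmxA.
have : horner_mx N (u * char_poly M) = 1.
  rewrite -[RHS](rmorph1 (horner_mx N)) -uv [RHS]rmorphD /= (rmorphM _ v) /=.
  by rewrite Cayley_Hamilton mulr0 addr0.
rewrite mulrC rmorphM /= -mulmxE => ->.
by rewrite mulmx1.
Qed.
End HermitianLyapunov.

(** * Stable invariant subspaces of Hamiltonian matrices *)

Lemma eigenvector_horner (F : fieldType) N (M : 'M[F]_N.+1) (u : 'rV_N.+1) l q :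
  u *m M = l *: u -> u *m horner_mx M q = q.[l] *: u.
Proof.
move=> uM; elim/poly_ind: q => [|q c IH]; first by rewrite rmorph0 mulmx0 horner0 scale0r.
rewrite rmorphD rmorphM /= horner_mx_X horner_mx_C mulmxDr -mulmxE mulmxA IH.
rewrite hornerMXaddC -scalemxAl scalerDl uM scalerA; congr (_ + _).
by rewrite mul_mx_scalar.
Qed.

Section SkewPairing.
Variable C : numClosedFieldType.
Local Notation "M ^h" := (map_mx (@Num.conj C) M^T) (at level 2, format "M ^h").
Variables (N : nat) (H J : 'M[C]_N.+1).
Hypotheses (HJ : H *m J = - (J *m H^h)) (uJ : J \in unitmx).
Hypothesis noimag : forall l, eigenvalue H l -> l + l^* != 0.

(** Passing [J] across the adjoint of [H + r^*] gives [- (H - r)]; [c] collects the signs, and its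
    value is irrelevant later. *)
Lemma sympl_horner (rs : seq C) : exists c,
  J *m (horner_mx H (\prod_(r <- rs) ('X + (r^*)%:P)))^h =
  c *: (horner_mx H (\prod_(r <- rs) ('X - r%:P)) *m J).
Proof.
elim: rs => [|r rs [c IH]].
  by exists 1; rewrite !big_nil !rmorph1 trmx1 map_mx1 mulmx1 scale1r mul1mx.
exists (- c); rewrite !big_cons mulrC !rmorphM.
set P := horner_mx _ (\prod_(r <- rs) _) in IH *.
set Q := horner_mx _ (\prod_(r <- rs) _) in IH *.
rewrite rmorphD rmorphB /= !horner_mx_X !horner_mx_C -!mulmxE ctmxM mulmxA.
have -> : J *m (H + (r^*)%:M)^h = - ((H - r%:M) *m J).
  rewrite ctmxD mulmxDr mulmxBl HJ tr_scalar_mx map_scalar_mx /= conjCK.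
  by rewrite mul_scalar_mx mul_mx_scalar opprB opprK addrC.
transitivity (- ((H - r%:M) *m (J *m P^h))); first by rewrite mulNmx -mulmxA.
by rewrite IH -scalemxAr mulmxA -scaleNr.
Qed.

(* The polynomial with roots [- r^*], which [J] exchanges with [p] up to adjoint, is
   coprime to [p], hence acts invertibly on the kernel of [p H]. *)
Lemma isotropic_ker (rs : seq C) : (forall r s, r \in rs -> s \in rs -> r + s^* != 0) ->
  let K := kermxpoly H (\prod_(r <- rs) ('X - r%:P)) in K *m J *m K^h = 0.
Proof.
move=> rs0 K; set p := \prod_(r <- rs) _ in K *.
pose q := \prod_(r <- rs) ('X + (r^*)%:P).
have /Bezout_eq1_coprimepP[[u v] /= uv] : coprimep p q.
  apply: Pdiv.ClosedField.root_coprimep => x; rewrite root_prod_XsubC => xrs.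
  rewrite horner_prod; rewrite prodf_seq_neq0; apply/allP => r rrs /=.
  by rewrite hornerD hornerX hornerC rs0.
have Kp : K *m horner_mx H p = 0 by exact: mulmx_ker.
have KE : K = K *m horner_mx H v *m horner_mx H q.
  have /= := congr1 (fun t => K *m horner_mx H t) uv; rewrite rmorph1 mulmx1 => {1}<-.
  by rewrite rmorphD mulmxDr [u * p]mulrC !rmorphM /= -!mulmxE !mulmxA Kp mul0mx add0r.
have [c cE] := sympl_horner rs.
rewrite {2}KE ctmxM mulmxA -(mulmxA K) cE -scalemxAr !mulmxA Kp !mul0mx.
by rewrite scaler0 mul0mx.
Qed.

Lemma isotropic_rank (K : 'M[C]_N.+1) : K *m J *m K^h = 0 -> (\rank K + \rank K <= N.+1)%N.
Proof. by move=> /mulmx0_rank_max; rewrite mxrank_map mxrank_tr mxrankMfree ?row_free_unit. Qed.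

(* The kernels belonging to the two half planes are isotropic, so of dimension at most
   half, and they span the space. *)
Lemma stable_kernel : exists rs : seq C, [/\ (forall r, r \in rs -> r + r^* < 0) &
  let r := \rank (kermxpoly H (\prod_(r <- rs) ('X - r%:P))) in (r + r = N.+1)%N].
Proof.
have [rs] := closed_field_poly_normal (char_poly H).
rewrite (monicP (char_poly_monic H)) scale1r => rsE.
have rsn r : r \in rs -> r + r^* != 0.
  by move=> rrs; apply: noimag; rewrite eigenvalue_root_char rsE root_prod_XsubC.
have rR (r : C) : r + r^* \is Num.real by apply/CrealP; rewrite rmorphD /= conjCK addrC.
pose neg (r : C) := r + r^* < 0.
have rs_pos r : r \in [seq x <- rs | predC neg x] -> 0 < r + r^*.
  rewrite mem_filter /= /neg => /andP[r0 /rsn rn].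
  by rewrite lt_def rn real_leNgt ?real0.
have rs_neg r : r \in [seq x <- rs | neg x] -> r + r^* < 0 by rewrite mem_filter => /andP[].
exists ([seq x <- rs | neg x]); split => //.
have sgn (r s : C) : (r + s^*) + (r + s^*)^* = (r + r^*) + (s + s^*).
  by rewrite rmorphD /= conjCK; ring.
set K1 := kermxpoly _ _.
set K2 := kermxpoly H (\prod_(r <- [seq x <- rs | predC neg x]) ('X - r%:P)).
have r1 : (\rank K1 + \rank K1 <= N.+1)%N.
  apply/isotropic_rank/isotropic_ker => r s /rs_neg r0 /rs_neg s0; apply/eqP => E.
  have := sgn r s; rewrite E conjC0 addr0 => E0.
  by have := ltrD r0 s0; rewrite -E0 addr0 ltxx.
have r2 : (\rank K2 + \rank K2 <= N.+1)%N.
  apply/isotropic_rank/isotropic_ker => r s /rs_pos r0 /rs_pos s0; apply/eqP => E.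
  have := sgn r s; rewrite E conjC0 addr0 => E0.
  by have := ltrD r0 s0; rewrite -E0 addr0 ltxx.
have cop : coprimep (\prod_(r <- [seq x <- rs | neg x]) ('X - r%:P))
    (\prod_(r <- [seq x <- rs | predC neg x]) ('X - r%:P)).
  apply: Pdiv.ClosedField.root_coprimep => x; rewrite root_prod_XsubC => /rs_neg x0.
  rewrite -[_ != 0]/(~~ root _ _) root_prod_XsubC; apply/negP => /rs_pos.
  by move=> /(lt_trans x0); rewrite ltxx.
(* The two coprime factors multiply to the characteristic polynomial, so by Cayley-Hamilton the two
   kernels sum to the whole space and both rank bounds are equalities. *)
have := kermxpolyM H cop; rewrite -big_cat /=.
rewrite (perm_big rs) /=; last by rewrite perm_filterC.
rewrite -rsE /kermxpoly Cayley_Hamilton => E0; have := E0.1.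
rewrite -/K1 -/K2 mxrank_ker mxrank0 subn0 => E.
have := (mxrank_adds_leqif K1 K2).1; rewrite -E.
by lia.
Qed.

End SkewPairing.

Section Hamiltonian.
Variable C : numClosedFieldType.
Local Notation "M ^h" := (map_mx (@Num.conj C) M^T) (at level 2, format "M ^h").
Variables (n : nat) (A W S : 'M[C]_n.+1).
Hypotheses (hW : W^h = W) (hS : S^h = S).
Hypothesis dS : forall x : 'rV[C]_n.+1, x *m S *m x^h = 0 -> x = 0.

(** Acting on row vectors, it satisfies [[1 X] H = (A + X S) [1 X]] exactly when [X] solves the
    Riccati equation, so solutions are invariant graphs. *)
Definition hamiltonian : 'M[C]_(n.+1 + n.+1) := block_mx A (- W) S (- A^h).
Local Notation H := hamiltonian.
Hypothesis noimag : forall l, eigenvalue H l -> l + l^* != 0.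

Definition sympl : 'M[C]_(n.+1 + n.+1) := block_mx 0 1%:M (- 1%:M) 0.
Local Notation J := sympl.

Lemma hamiltonianJ : H *m J = - (J *m H^h).
Proof.
rewrite /H /J tr_block_mx map_block_mx !mulmx_block opp_block_mx.
rewrite !mul0mx !mulmx0 !add0r !addr0 !linearN /= !map_mxN /= ctmxK hW hS.
by rewrite !mulmx1 !mul1mx ?mulmxN ?mulNmx ?mulmx1 ?mul1mx ?opprK.
Qed.

Lemma symplV : J *m J = - 1%:M.
Proof.
rewrite /J mulmx_block !mul0mx !mulmx0 !add0r !addr0 !mulmx1 !mul1mx.
by rewrite (scalar_mx_block n.+1 n.+1) opp_block_mx oppr0.
Qed.

Lemma sympl_unit : J \in unitmx.
Proof.
apply: (proj1 (mulmx1_unit (_ : J *m (- J) = 1%:M))).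
by rewrite mulmxN symplV opprK.
Qed.

Lemma riccati_stabilizing : exists2 X : 'M[C]_n.+1,
  A *m X + X *m A^h + X *m S *m X + W = 0 &
  forall l, eigenvalue (A + X *m S) l -> l + l^* < 0.
Proof.
have [rs [rs_neg]] := @stable_kernel C (n + n.+1)%N H J hamiltonianJ sympl_unit noimag.
set p := \prod_(r <- rs) _ => /= rK2.
pose K : 'M[C]_(n.+1 + n.+1) := kermxpoly H p.
have rK : (\rank K + \rank K = n.+1 + n.+1)%N by [].
have {rK2}rK2 : \rank K = n.+1 by lia.
have KJ : K *m J *m K^h = 0.
  apply: (isotropic_ker _ _ _ J hamiltonianJ) => r s /rs_neg r0 /rs_neg s0; apply/eqP => E.
  have E2 : (r + s^*) + (r + s^*)^* = (r + r^*) + (s + s^*) by rewrite rmorphD /= conjCK; ring.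
  by have := ltrD r0 s0; rewrite -E2 E conjC0 !addr0 ltxx.
have Kp : K *m (horner_mx H p : 'M[C]_(n.+1 + n.+1)) = 0 by exact: mulmx_ker.
have [L0 KH] : exists L0 : 'M[C]_(n.+1 + n.+1), K *m H = L0 *m K.
  by apply/submxP/comm_mx_stable_kermxpoly.
clear rK; move: K rK2 KJ Kp KH => K rK2 KJ Kp KH.
pose K1 := lsubmx (K : 'M[C]_(n.+1 + n.+1)); pose K2 := rsubmx (K : 'M[C]_(n.+1 + n.+1)).
have KE : K = row_mx K1 K2 by rewrite hsubmxK.
have K12 : K2 *m K1^h = K1 *m K2^h.
  move: KJ; rewrite KE /J mul_row_block !mulmx0 add0r addr0 mulmx1 mulmxN mulmx1.
  rewrite tr_row_mx map_col_mx mul_row_col mulNmx addrC => /eqP.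
  by rewrite subr_eq0 => /eqP ->.
have KA : K1 *m A + K2 *m S = L0 *m K1.
  by move: KH; rewrite KE /H mul_row_block mul_mx_row => /eq_row_mx[].
(* The graph property. If [v K1 = 0], invariance replaces [v K2 S] by [v L0 K1], and isotropy moves
   [K1^h] next to [v^h], where it vanishes. So the [S]-form of [v K2] is zero. *)
have inj (v : 'rV_(n.+1 + n.+1)) : v *m K1 = 0 -> v *m K = 0.
  move=> vK1; rewrite KE mul_mx_row vK1 (_ : v *m K2 = 0) ?row_mx0//.
  apply: dS; rewrite ctmxM -(mulmxA v) !mulmxA.
  have -> : v *m K2 *m S *m K2^h *m v^h = v *m (K2 *m S) *m K2^h *m v^h by rewrite !mulmxA.
  have -> : K2 *m S = L0 *m K1 - K1 *m A by rewrite -KA addrAC subrr add0r.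
  rewrite mulmxBr !mulmxA vK1 mul0mx subr0 -(mulmxA (v *m L0)) -K12 !mulmxA.
  by rewrite -(mulmxA _ K1^h) -ctmxM vK1 trmx0 map_mx0 mulmx0.
have rK1 : \rank K1 = n.+1.
  have : (\rank (kermx K1) <= \rank (kermx K))%N.
    apply/mxrankS/row_subP => i; apply/sub_kermxP/inj.
    by apply/sub_kermxP; apply: row_sub.
  by rewrite !mxrank_ker; have := rank_leq_col K1; have := rank_leq_row K; lia.
(* [K] has twice as many rows as its rank, so [K1] is not square; a left inverse [L] selects the
   basis [[1 X]] of the row space. *)
have /row_fullP[L LK1] : row_full K1 by rewrite /row_full rK1.
pose X := L *m K2.
have GE : L *m K = row_mx 1%:M X by rewrite KE mul_mx_row LK1.
have rG : \rank (L *m K) = n.+1.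
  apply/eqP; rewrite eqn_leq rank_leq_row -[X in (X <= _)%N](mxrank1 C n.+1).
  have -> : 1%:M = L *m K *m col_mx 1%:M 0 :> 'M[C]_n.+1.
    by rewrite GE mul_row_col mulmx0 addr0 mulmx1.
  exact: mxrankM_maxl.
have KG : (K <= L *m K)%MS.
  have := (mxrank_leqif_sup (submxMl L K)).2.
  by rewrite rG rK2 eqxx => <-.
have [L1 GH] : exists L1, L *m K *m H = L1 *m (L *m K).
  by apply/submxP; rewrite -mulmxA KH mulmxA (submx_trans _ KG)// submxMl.
have : row_mx (A + X *m S) (- W - X *m A^h) = row_mx L1 (L1 *m X).
  move: GH; rewrite GE /H mul_row_block mul_mx_row !mul1mx mulmx1.
  by rewrite mulmxN.
move=> /eq_row_mx[EL ER]; rewrite -EL in ER GH => {EL L1}.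
exists X.
  have -> : A *m X + X *m A^h + X *m S *m X + W = (A + X *m S) *m X - (- W - X *m A^h).
    by rewrite mulmxDl opprB opprK addrA (addrAC (A *m X)).
  by rewrite ER subrr.
(* A left eigenvector [v] of [A + X S] lifts to the eigenvector [v [1 X]] of [H], which lies in the
   kernel of [p(H)]; hence [l] is a root of [p]. *)
move=> l /eigenvalueP[v vl v0]; apply: rs_neg.
rewrite -root_prod_XsubC -/p.
have vH : v *m (L *m K) *m H = l *: (v *m (L *m K)) by rewrite -mulmxA GH mulmxA vl scalemxAl.
have /= := eigenvector_horner _ _ _ _ _ p vH.
have -> : v *m (L *m K) *m (horner_mx H p : 'M[C]_(n.+1 + n.+1)) = 0.
  by rewrite -!mulmxA Kp !mulmx0.
move=> /esym/eqP.
rewrite scaler_eq0 -/(root p l) => /orP[//|/eqP].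
rewrite GE mul_mx_row mulmx1 => v00.
have {}v00 : v = 0 by rewrite -[v](row_mxKl v (v *m X)) v00 linear0.
by rewrite v00 eqxx in v0.
Qed.

End Hamiltonian.

(** * Real matrices and their complexification *)

Section RealForms.
Variable R : realType.
Local Notation "M ^h" := (map_mx (@Num.conj R[i]) M^T) (at level 2, format "M ^h").

Lemma conj_real (x : R) : Num.conj (x%:C)%C = (x%:C)%C.
Proof. exact: conjc_real. Qed.

Lemma add_conj (l : R[i]) : l + Num.conj l = ((2 * complex.Re l)%:C)%C.
Proof. by rewrite -[Num.conj l]/(conjc l) addcJ rmorphM rmorph_nat. Qed.

Lemma Re_conj_lt0 (l : R[i]) : (l + Num.conj l < 0) = (complex.Re l < 0).
Proof. by rewrite add_conj -(rmorph0 (real_complex R)) ltcR pmulr_rlt0// ltr0n. Qed.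

Lemma hurwitzP n (M : 'M[R]_n) :
  hurwitz M <-> forall l, eigenvalue (cmx M) l -> l + Num.conj l < 0.
Proof. by split => hM l /hM; rewrite Re_conj_lt0. Qed.

Lemma cmxM m n p (M : 'M[R]_(m, n)) (N : 'M[R]_(n, p)) : cmx (M *m N) = cmx M *m cmx N.
Proof. exact: map_mxM. Qed.

Lemma cmxD m n (M N : 'M[R]_(m, n)) : cmx (M + N) = cmx M + cmx N.
Proof. exact: map_mxD. Qed.

Lemma cmxN m n (M : 'M[R]_(m, n)) : cmx (- M) = - cmx M.
Proof. exact: map_mxN. Qed.

Lemma cmxZ m n a (M : 'M[R]_(m, n)) : cmx (a *: M) = (a%:C)%C *: cmx M.
Proof. exact: map_mxZ. Qed.

Lemma cmx_tr m n (M : 'M[R]_(m, n)) : (cmx M)^T = cmx M^T.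
Proof. by rewrite /cmx map_trmx. Qed.

Lemma cmx_adj m n (M : 'M[R]_(m, n)) : (cmx M)^h = cmx M^T.
Proof. by apply/matrixP => i j; rewrite !mxE conj_real. Qed.

Lemma cmx_inj m n : injective (@cmx R m n).
Proof. by move=> M N /matrixP MN; apply/matrixP => i j; have := MN i j; rewrite !mxE => -[]. Qed.

Lemma row_complex n (x : 'rV[R[i]]_n) :
  x = cmx (map_mx (@complex.Re R) x) + 'i%C *: cmx (map_mx (@complex.Im R) x).
Proof. by apply/rowP => i; rewrite !mxE -complexE. Qed.

Lemma form_complex n (M : 'M[R]_n) (x : 'rV[R[i]]_n) : M^T = M ->
  let a := map_mx (@complex.Re R) x in let b := map_mx (@complex.Im R) x in
  (x *m cmx M *m x^h) 0 0 = (((a *m M *m a^T) 0 0 + (b *m M *m b^T) 0 0)%:C)%C.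
Proof.
move=> sM a b; rewrite {1 2}(row_complex _ x) -/a -/b.
rewrite ctmxD ctmxZ !cmx_adj mulmxDl !mulmxDr -!scalemxAl !mulmxDl -!scalemxAl -!scalemxAr.
rewrite scalerA -!cmxM.
have -> : b *m M *m a^T = a *m M *m b^T.
  have tr1 (Z : 'M[R]_1) : Z^T = Z by apply/matrixP => i j; rewrite mxE !ord1.
  by rewrite -[LHS]tr1 !trmx_mul trmxK sM mulmxA.
have -> : Num.conj ('i%C : R[i]) = - 'i%C by apply/eqP; rewrite eq_complex /= oppr0 !eqxx.
rewrite mulrN -expr2 sqr_i opprK scale1r scaleNr addrA addrK.
by rewrite -cmxD mxE addmxE.
Qed.

Lemma psd_psdC n (M : 'M[R]_n) : psd M -> psdC _ n (cmx M).
Proof.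
move=> [sM pM] x; rewrite form_complex// ler0c addr_ge0//.
  by have := pM (map_mx (@complex.Re R) x)^T; rewrite trmxK.
by have := pM (map_mx (@complex.Im R) x)^T; rewrite trmxK.
Qed.

Lemma psdC_psd n (M : 'M[R]_n) : M^T = M -> psdC _ n (cmx M) -> psd M.
Proof.
move=> sM pM; split=> // x; have := pM (cmx x^T).
by rewrite cmx_adj trmxK -!cmxM mxE ler0c.
Qed.

Lemma lyapunov_real n (M P : 'M[R]_n) : hurwitz M -> P^T = P ->
  psd (- (M *m P + P *m M^T)) -> psd P.
Proof.
move=> /hurwitzP hM sP /psd_psdC pN; apply: (psdC_psd _ _ sP).
have hP : (cmx P)^h = cmx P by rewrite cmx_adj sP.
apply: (lyapunov _ _ _ _ hM hP).
by rewrite cmx_adj -!cmxM -cmxD -cmxN.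
Qed.

Lemma psd_tr_mul n (P Q : 'M[R]_n) : psd P -> psd Q -> 0 <= \tr (P *m Q).
Proof.
move=> pP pQ; rewrite -ler0c -trace_map_mx -/(cmx _) cmxM; apply: psdC_tr.
- by rewrite cmx_adj (proj1 pP).
- exact: psd_psdC.
- exact: psd_psdC.
Qed.

Lemma eigenvalue_adj n (M : 'M[R[i]]_n) l : eigenvalue M^h l = eigenvalue M (Num.conj l).
Proof.
have ctr (N : 'M[R[i]]_n) : char_poly N^T = char_poly N.
  rewrite /char_poly -[RHS]det_tr; congr (\det _); apply/matrixP => i j.
  by rewrite !mxE eq_sym.
rewrite !eigenvalue_root_char -map_char_poly ctr -[l in LHS]conjCK.
exact: (fmorph_root (@Num.conj R[i])).
Qed.

Lemma eigenvalue_tr n (M : 'M[R[i]]_n) l : eigenvalue M^T l = eigenvalue M l.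
Proof.
rewrite !eigenvalue_root_char /char_poly -[in LHS]det_tr; congr (root (\det _) _).
by apply/matrixP => i j; rewrite !mxE eq_sym.
Qed.

(** The spectra of [M] and [- N] lie in opposite open half planes. *)
Lemma sylvester_stable m n (M : 'M[R[i]]_m) (N : 'M[R[i]]_n) Y :
  (forall l, eigenvalue M l -> l + Num.conj l < 0) ->
  (forall l, eigenvalue N l -> l + Num.conj l < 0) ->
  M *m Y + Y *m N = 0 -> Y = 0.
Proof.
move=> sM sN /eqP; rewrite addr_eq0 -mulmxN => /eqP; apply: sylvester0.
move=> l /sM l0; apply/negP => /eigenvalueP[v vN v0].
have : eigenvalue N (- l).
  by apply/eigenvalueP; exists v => //; rewrite scaleNr -vN mulmxN opprK.
by move=> /sN /(ltrD l0); rewrite rmorphN /= addr0 -opprD subrr ltxx.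
Qed.

Lemma sylvester_real m n (M : 'M[R]_m) (N : 'M[R]_n) Y : hurwitz M -> hurwitz N ->
  M *m Y + Y *m N = 0 -> Y = 0.
Proof.
move=> /hurwitzP hM /hurwitzP hN E; apply: cmx_inj; rewrite [RHS]map_mx0.
by apply: (sylvester_stable _ _ _ _ _ hM hN); rewrite -!cmxM -cmxD E [LHS]map_mx0.
Qed.

Lemma hurwitz_tr n (M : 'M[R]_n) : hurwitz M -> hurwitz M^T.
Proof. by move=> hM l; rewrite -cmx_tr eigenvalue_tr => /hM. Qed.

(** The Lyapunov operator, written as a matrix on vectorized [P], is injective by [sylvester_real],
    hence invertible; symmetry follows because [P^T] solves the same equation. *)
Lemma lyapunov_solvable n (A Q : 'M[R]_n) : hurwitz A -> Q^T = Q ->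
  exists2 P : 'M[R]_n, P^T = P & A^T *m P + P *m A = Q.
Proof.
move=> hA sQ; pose L := lin_mulmx A^T + lin_mulmxr A : 'M[R]_(n * n).
have LE P : mxvec P *m L = mxvec (A^T *m P + P *m A).
  by rewrite mulmxDr !mul_vec_lin linearD.
have inj (P : 'M[R]_n) : A^T *m P + P *m A = 0 -> P = 0.
  exact/sylvester_real/hA/hurwitz_tr.
have uL : L \in unitmx.
  rewrite -row_free_unit; apply: inj_row_free => v.
  rewrite -[v]vec_mxK LE => /eqP; rewrite mxvec_eq0 => /eqP/inj ->.
  by rewrite linear0.
pose P := vec_mx (mxvec Q *m invmx L).
have PE : A^T *m P + P *m A = Q.
  by apply: (can_inj mxvecK); rewrite -LE vec_mxK mulmxKV.
exists P => //; apply/eqP; rewrite -subr_eq0; apply/eqP/inj.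
have PtE : A^T *m P^T + P^T *m A = Q.
  by rewrite -[RHS]sQ -PE [RHS]linearD /= !trmx_mul trmxK addrC.
by rewrite mulmxBr mulmxBl addrACA -opprD PE PtE subrr.
Qed.

End RealForms.

(** * Real stabilizing solutions of the Riccati equation *)

Section BoundedReal.
Variable R : realType.
Local Notation "M ^h" := (map_mx (@Num.conj R[i]) M^T) (at level 2, format "M ^h").

(** Writing [X S X - Y S Y] as [X S (X - Y) + (X - Y) S Y] leaves a Sylvester equation for [X - Y];
    stable coefficients then force [X = Y]. *)
Lemma riccati_diff (F : comNzRingType) n (A B W S X Y : 'M[F]_n) :
  A *m X + X *m B + X *m S *m X + W = 0 -> A *m Y + Y *m B + Y *m S *m Y + W = 0 ->
  (A + X *m S) *m (X - Y) + (X - Y) *m (B + S *m Y) = 0.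
Proof.
move=> hX hY.
transitivity (A *m X + X *m B + X *m S *m X + W - (A *m Y + Y *m B + Y *m S *m Y + W)).
  rewrite !mulmxDl !mulmxDr ?mulmxN ?mulNmx !mulmxA.
  set a := A *m X; set b := A *m Y; set c := X *m S *m X; set d := X *m S *m Y.
  set e := Y *m S *m Y; set f := X *m B; set g := Y *m B.
  by apply/matrixP => i j; rewrite !mxE; ring.
by rewrite hX hY subrr.
Qed.

Lemma pd_form0 n (S : 'M[R]_n) (x : 'rV[R[i]]_n) : pd S ->
  x *m cmx S *m x^h = 0 -> x = 0.
Proof.
move=> [sS pS] /matrixP/(_ 0 0); rewrite form_complex// [RHS]mxE => /eqP.
rewrite -(rmorph0 (real_complex R)) (inj_eq (@complexI R)).
have f (a : 'rV[R]_n) : 0 <= (a *m S *m a^T) 0 0 /\ ((a *m S *m a^T) 0 0 = 0 -> a = 0).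
  have [->|a0] := eqVneq a 0; first by rewrite !mul0mx mxE.
  have := pS a^T; rewrite trmxK trmx_eq0 => /(_ a0) h; split; first exact: ltW.
  by move=> h0; rewrite h0 ltxx in h.
set a := map_mx _ _; set b := map_mx _ _.
rewrite paddr_eq0 ?(f a).1 ?(f b).1// => /andP[/eqP/(f a).2 a0 /eqP/(f b).2 b0].
by rewrite (row_complex _ _ x) -/a -/b a0 b0 /cmx !map_mx0 scaler0 addr0.
Qed.

(* The transpose and the adjoint of a stabilizing solution are stabilizing solutions as
   well; uniqueness makes it symmetric and Hermitian, hence real. *)
Lemma riccati_real n (A W S : 'M[R]_n) : W^T = W -> pd S ->
  (forall (l : R[i]) (x y : 'rV_n), l + Num.conj l = 0 ->
     x *m cmx A + y *m cmx S = l *: x -> x *m cmx W + y *m cmx A^T = - l *: y ->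
     x = 0 /\ y = 0) ->
  exists2 X : 'M[R]_n, A *m X + X *m A^T + X *m S *m X + W = 0 & hurwitz (A + X *m S).
Proof.
case: n A W S => [|n] A W S sW pS imag.
  exists 0; first by rewrite [LHS]flatmx0.
  by move=> l /eigenvalueP[v _]; rewrite [v]thinmx0 eqxx.
have sS : S^T = S := pS.1.
have hW : (cmx W)^h = cmx W by rewrite cmx_adj sW.
have hS : (cmx S)^h = cmx S by rewrite cmx_adj sS.
have dS (x : 'rV_n.+1) : x *m cmx S *m x^h = 0 -> x = 0 by apply: (pd_form0 _ _ _ pS).
(* The hypothesis [imag] is the left eigenvector equation of the Hamiltonian matrix in blocks, with
   the sign of the second block moved to [l]. *)
have noimag l : eigenvalue (hamiltonian _ n (cmx A) (cmx W) (cmx S)) l -> l + Num.conj l != 0.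
  move=> /eigenvalueP[v vH]; apply: contra_neq => l0.
  rewrite -[v]hsubmxK in vH *; move: vH; set x := lsubmx v; set y := rsubmx v.
  rewrite mul_row_block scale_row_mx cmx_adj => /eq_row_mx[E1 E2].
  have E3 : x *m cmx W + y *m cmx A^T = - l *: y.
    by rewrite !mulmxN -opprD in E2; rewrite scaleNr -E2 opprK.
  by have [-> ->] := imag l x y l0 E1 E3; rewrite row_mx0.
have [X XE hX] := riccati_stabilizing _ _ _ _ _ hW hS dS noimag.
rewrite cmx_adj in XE.
have XtE : cmx A *m X^T + X^T *m cmx A^T + X^T *m cmx S *m X^T + cmx W = 0.
  have := congr1 trmx XE; rewrite !linearD /= !trmx_mul !cmx_tr trmx0 trmxK sS sW mulmxA => E.
  by rewrite [cmx A *m X^T + _]addrC; exact: E.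
have XhE : cmx A *m X^h + X^h *m cmx A^T + X^h *m cmx S *m X^h + cmx W = 0.
  have := congr1 (fun Z : 'M[R[i]]_(n.+1) => Z^h) XE.
  rewrite !ctmxD !ctmxM !cmx_adj trmx0 map_mx0 trmxK sS sW mulmxA => E.
  by rewrite [cmx A *m X^h + _]addrC; exact: E.
have Xt : X = X^T.
  apply/eqP; rewrite -subr_eq0; apply/eqP.
  apply: (sylvester_stable _ _ _ _ _ _ hX _ (riccati_diff _ _ _ _ _ _ _ _ XE XtE)).
  have -> : cmx A^T + cmx S *m X^T = (cmx A + X *m cmx S)^T.
    by rewrite linearD /= trmx_mul !cmx_tr sS.
  by move=> l; rewrite eigenvalue_tr; apply: hX.
have Xh : X = X^h.
  apply/eqP; rewrite -subr_eq0; apply/eqP.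
  apply: (sylvester_stable _ _ _ _ _ _ hX _ (riccati_diff _ _ _ _ _ _ _ _ XE XhE)).
  have -> : cmx A^T + cmx S *m X^h = (cmx A + X *m cmx S)^h.
    by rewrite ctmxD ctmxM !cmx_adj sS.
  by move=> l; rewrite eigenvalue_adj => /hX; rewrite conjCK addrC.
pose Y := map_mx (@complex.Re R) X.
have XY : X = cmx Y.
  apply/matrixP => i j; have /matrixP/(_ i j) := Xh; rewrite {2}Xt !mxE.
  by case: (X i j) => a b [] b0; congr Complex; lra.
exists Y.
  by apply: cmx_inj; rewrite !cmxD !cmxM -XY XE [RHS]map_mx0.
by apply/hurwitzP; rewrite cmxD cmxM -XY.
Qed.

End BoundedReal.

(** * The bounded real lemma *)

Section HinfNorm.
Variable R : realType.
Local Notation "M ^h" := (map_mx (@Num.conj R[i]) M^T) (at level 2, format "M ^h").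

Lemma cnorm2E p (v : 'cV[R[i]]_p) : ((cnorm2 v)%:C)%C = (v^h *m v) 0 0.
Proof.
rewrite mxE /cnorm2 rmorph_sum; apply: eq_bigr => i _ /=.
by rewrite !mxE add_Re2_Im2 sqr_normc mulrC.
Qed.

Lemma cnorm2_ge0 p (v : 'cV[R[i]]_p) : 0 <= cnorm2 v.
Proof. by apply: sumr_ge0 => i _; rewrite addr_ge0 ?sqr_ge0. Qed.

Lemma cnorm2_eq0 p (v : 'cV[R[i]]_p) : (cnorm2 v == 0) = (v == 0).
Proof.
apply/idP/eqP => [|->]; last first.
  by rewrite /cnorm2 big1// => i _; rewrite mxE /= expr0n addr0.
rewrite psumr_eq0 => [/allP v0|i _]; last by rewrite addr_ge0 ?sqr_ge0.
apply/matrixP => i j; rewrite ord1 mxE; have := v0 i (mem_index_enum i).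
rewrite paddr_eq0 ?sqr_ge0// !sqrf_eq0 => /andP[/eqP r0 /eqP i0].
by apply/eqP; rewrite eq_complex r0 i0 /= eqxx.
Qed.

Lemma cnorm2_norm p (v : 'cV[R[i]]_p) : ((cnorm2 v)%:C)%C = \sum_i `|v i 0| ^+ 2.
Proof. by rewrite /cnorm2 rmorph_sum; apply: eq_bigr => i _; exact: add_Re2_Im2. Qed.

(** Each [|v j|] is at most [t], the square root of [cnorm2 v], so row [i] contributes at most
    [(s i * t) ^+ 2], where [s i] is the absolute row sum. *)
Lemma cnorm2_mul_le p q (M : 'M[R[i]]_(p, q)) :
  exists2 c : R, 0 <= c & forall v : 'cV_q, cnorm2 (M *m v) <= c * cnorm2 v.
Proof.
pose s i : R[i] := \sum_j `|M i j|.
have s0 i : 0 <= s i by apply: sumr_ge0.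
have c0 : 0 <= \sum_i s i ^+ 2 by apply: sumr_ge0 => i _; apply: exprn_ge0.
have cE := RRe_real (ger0_real c0).
exists (complex.Re (\sum_i s i ^+ 2)); first by rewrite -ler0c cE.
move=> v; rewrite -lecR rmorphM /= cE.
have n0 : 0 <= ((cnorm2 v)%:C)%C by rewrite ler0c cnorm2_ge0.
pose t := sqrtC ((cnorm2 v)%:C)%C.
have t0 : 0 <= t by rewrite sqrtC_ge0.
have tE : ((cnorm2 v)%:C)%C = t ^+ 2 by rewrite sqrtCK.
have vt j : `|v j 0| <= t.
  rewrite -(@ler_pXn2r _ 2%N)// ?nnegrE// -tE cnorm2_norm (bigD1 j)//= lerDl.
  by apply: sumr_ge0 => i _; apply: exprn_ge0.
rewrite tE cnorm2_norm mulr_suml; apply: ler_sum => i _; rewrite -exprMn.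
rewrite ler_pXn2r ?nnegrE ?mulr_ge0// mxE (le_trans (ler_norm_sum _ _ _))//.
by rewrite mulr_suml; apply: ler_sum => j _; rewrite normrM ler_wpM2l.
Qed.

Lemma stable_resolvent_unit n (A : 'M[R]_n) (w : R) : hurwitz A ->
  ((w *i)%C%:M - cmx A) \in unitmx.
Proof.
move=> hA; rewrite -row_free_unit; apply: inj_row_free => v.
rewrite mulmxBr mul_mx_scalar => /eqP; rewrite subr_eq0 => /eqP vA; apply/eqP/contraT => v0.
have /hA /= : eigenvalue (cmx A) (w *i)%C by apply/eigenvalueP; exists v.
by rewrite ltxx.
Qed.

(* With [A^T P + P A = -1] and [xi = (jw - A)^-1 B v], [|xi|^2 = 2 Re (xi^* P B v)].
   Without this bound, [sup] in [hinf_norm] could take its junk value [0]. *)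
Lemma freq_resp_bounded p q n (C : 'M[R]_(p, n)) (A : 'M[R]_n) (B : 'M[R]_(n, q)) :
  hurwitz A -> exists c : R, forall w v, cnorm2 (freq_resp C A B w *m v) <= c * cnorm2 v.
Proof.
move=> hA.
have s1 : (- 1%:M : 'M[R]_n)^T = - 1%:M by rewrite linearN /= trmx1.
have [P sP PE] := lyapunov_solvable _ _ A _ hA s1.
have [c c0 cC] := cnorm2_mul_le _ _ (cmx C).
have [d d0 dP] := cnorm2_mul_le _ _ (cmx P *m cmx B).
exists (c * (4 * d)) => w v; rewrite /freq_resp -!mulmxA; set xi := invmx _ *m _.
apply: (le_trans (cC _)); rewrite -!mulrA ler_wpM2l//.
pose l : R[i] := (w *i)%C.
have uN := stable_resolvent_unit _ A w hA.
have xiE : cmx A *m xi = l *: xi - cmx B *m v.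
  have : (l%:M - cmx A) *m xi = cmx B *m v by rewrite /xi mulKVmx.
  by rewrite mulmxBl mul_scalar_mx => <-; rewrite opprB addrC subrK.
clearbody xi; have [z zE] : exists z, z = cmx B *m v by exists (cmx B *m v).
rewrite -zE in xiE; pose y := cmx P *m z.
have ll : Num.conj l = - l by apply/eqP; rewrite eq_complex /= oppr0 !eqxx.
have E : xi^h *m xi = xi^h *m y + y^h *m xi.
  have : xi^h *m (cmx (A^T *m P + P *m A)) *m xi = - (xi^h *m xi).
    by rewrite PE cmxN /cmx map_mx1 mulmxN mulmx1 mulNmx.
  have hP : (cmx P)^h = cmx P by rewrite cmx_adj sP.
  have T1 : xi^h *m cmx A^T *m cmx P *m xi = - l *: (xi^h *m cmx P *m xi) - y^h *m xi.
    by rewrite -cmx_adj -ctmxM xiE ctmxD ctmxN ctmxZ ll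
      !mulmxDl -!scalemxAl !mulNmx (ctmxM _ _ _ _ (cmx P) z) hP.
  have T2 : xi^h *m cmx P *m cmx A *m xi = l *: (xi^h *m cmx P *m xi) - xi^h *m y.
    by rewrite -mulmxA xiE mulmxDr mulmxN -scalemxAr /y mulmxA.
  rewrite cmxD !cmxM mulmxDr mulmxDl !mulmxA T1 T2 scaleNr.
  rewrite addrACA addNr add0r -opprD => /oppr_inj <-.
  by rewrite addrC -(mulmxA _ _ z).
(* As [|xi|^2 = 2 Re (xi^* y)], expanding gives [|xi - 2 y|^2 = 4 |y|^2 - |xi|^2]; this is the
   origin of the factor [4]. *)
have : 0 <= ((xi - 2 *: y)^h *m (xi - 2 *: y)) 0 0.
  by rewrite -cnorm2E ler0c cnorm2_ge0.
have -> : (xi - 2 *: y)^h *m (xi - 2 *: y) = 4 *: (y^h *m y) - xi^h *m xi.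
  have c2 : Num.conj (2 : R[i]) = 2 by exact: conjC_nat.
  rewrite ctmxD ctmxN ctmxZ c2 mulmxDl !mulmxDr !mulNmx !mulmxN -!scalemxAl -!scalemxAr.
  rewrite E scalerA; set a := xi^h *m y; set b := y^h *m xi; set e := y^h *m y.
  by apply/matrixP => i j; rewrite !mxE; ring.
rewrite addmxE oppmxE scalemxE -!cnorm2E subr_ge0 => h.
have {}h : cnorm2 xi <= 4 * cnorm2 y by rewrite -lecR rmorphM rmorph_nat.
by rewrite (le_trans h)// ler_wpM2l// /y zE mulmxA.
Qed.

Lemma hinf_norm_lt p q n (C : 'M[R]_(p, n)) (A : 'M[R]_n) (B : 'M[R]_(n, q)) beta w v :
  hurwitz A -> 0 < beta -> hinf_norm C A B < beta -> v != 0 ->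
  cnorm2 (freq_resp C A B w *m v) < beta ^+ 2 * cnorm2 v.
Proof.
move=> hA b0 hb v0; have [c hc] := freq_resp_bounded _ _ _ C A B hA.
have pos (u : 'cV[R[i]]_q) : u != 0 -> 0 < cnorm2 u.
  by move=> u0; rewrite lt_def cnorm2_eq0 u0 cnorm2_ge0.
rewrite -ltr_pdivrMr ?pos//.
move: hb; rewrite /hinf_norm; set E := [set r : R | _] => hb.
have : cnorm2 (freq_resp C A B w *m v) / cnorm2 v <= sup E.
  apply: ub_le_sup; last by exists w, v.
  by exists c => _ [w' [v' [v'0 ->]]]; rewrite ler_pdivrMr ?pos.
move=> /le_lt_trans; apply; rewrite ltNge; apply/negP => h.
move: hb; rewrite ltNge => /negP; apply.
by rewrite -[leLHS](ger0_norm (ltW b0)) -sqrtr_sqr ler_wsqrtr.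
Qed.

(* An eigenvector [(x, y)] of the Hamiltonian matrix at [jw] gives the input
   [v = B^T x^*] with gain exactly [beta] at the frequency [w]. *)
Lemma bounded_real p n (C : 'M[R]_(p, n)) (A B : 'M[R]_n) beta :
  hurwitz A -> 0 < beta -> hinf_norm C A B < beta ->
  pd (C^T *m C) -> pd (B *m B^T) ->
  exists2 X : 'M[R]_n,
    A *m X + X *m A^T + beta ^- 2 *: (X *m (C^T *m C) *m X) + B *m B^T = 0 &
    hurwitz (A + beta ^- 2 *: (X *m (C^T *m C))).
Proof.
move=> hA b0 hb pS pW.
have b2 : 0 < beta ^- 2 by rewrite invr_gt0 exprn_gt0.
pose S := beta ^- 2 *: (C^T *m C).
have pS' : pd S.
  split; first by rewrite /Defs.symmetric linearZ /= pS.1.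
  by move=> x x0; rewrite -scalemxAr -scalemxAl mxE mulr_gt0//; apply: pS.2.
have [] := riccati_real _ n A (B *m B^T) S pW.1 pS'; last first.
  by move=> X; rewrite /S -scalemxAr -scalemxAl => XE hX; exists X.
move=> l x y l0 E1 E2.
have [w lE] : exists w : R, l = (w *i)%C.
  exists (complex.Im l); move: l0; rewrite add_conj => -[/eqP].
  by rewrite mulf_eq0 pnatr_eq0 /= => /eqP r0; apply/eqP; rewrite eq_complex /= r0 !eqxx.
have ll : Num.conj l = - l by apply/eqP; rewrite -addr_eq0 addrC l0.
pose xi := y^h; pose v := cmx B^T *m x^h.
have Bv : (l%:M - cmx A) *m xi = cmx B *m v.
  rewrite /v mulmxA -cmxM /xi mulmxBl mul_scalar_mx.
  have := congr1 (fun Z : 'M[R[i]]_(1, n) => Z^h) E2.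
  rewrite ctmxD ctmxZ !ctmxM !cmx_adj trmxK pW.1 rmorphN /= ll opprK => <-.
  by rewrite addrK.
have Sxi : cmx S *m xi = (l%:M - cmx A)^h *m x^h.
  have := congr1 (fun Z : 'M[R[i]]_(1, n) => Z^h) E1.
  rewrite ctmxD ctmxZ !ctmxM !cmx_adj pS'.1 => E.
  rewrite ctmxD ctmxN cmx_adj tr_scalar_mx map_scalar_mx /= mulmxBl mul_scalar_mx -E.
  by rewrite addrAC subrr add0r.
have xiSxi : xi^h *m cmx S *m xi = v^h *m v.
  by rewrite -mulmxA Sxi mulmxA -ctmxM Bv ctmxM -mulmxA /v cmx_adj.
have uN := stable_resolvent_unit _ A w hA.
have xiE : cmx C *m xi = freq_resp C A B w *m v.
  by rewrite /freq_resp -!mulmxA -Bv lE mulKmx.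
have nE : cnorm2 (cmx C *m xi) = beta ^+ 2 * cnorm2 v.
  apply: (@complexI R); rewrite rmorphM /= !cnorm2E -xiSxi.
  rewrite ctmxM cmx_adj mulmxA -(mulmxA _ (cmx C^T)) -cmxM.
  rewrite /S cmxZ -scalemxAr -scalemxAl scalemxE mulrA -rmorphM /=.
  by rewrite mulfV ?mul1r// expf_neq0// gt_eqF.
(* A nonzero [v] would contradict the strict norm bound. Then [v = 0] gives [xi = 0] by
   invertibility of [jw - A], and definiteness of [B *m B^T] removes [x]. *)
have v0 : v = 0.
  apply/eqP/contraT => v0; have := hinf_norm_lt _ _ _ C A B beta w v hA b0 hb v0.
  by rewrite -xiE nE ltxx.
rewrite v0 mulmx0 lE in Bv.
have xi0 : xi = 0 by rewrite -[xi](mulKmx uN) Bv mulmx0.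
have y0 : y = 0 by rewrite -[y]ctmxK -/xi xi0 trmx0 map_mx0.
split=> //; apply: (pd_form0 _ _ _ _ pW).
have -> : x *m cmx (B *m B^T) = 0.
  by rewrite -[LHS]addr0 -[0 in LHS](mul0mx _ (cmx A^T)) -y0 E2 y0 scaler0.
by rewrite mul0mx.
Qed.
End HinfNorm.

(** * Convexity *)

Section PsdCalculus.
Variable R : realType.

Lemma pd_psd n (M : 'M[R]_n) : pd M -> psd M.
Proof.
move=> [sM pM]; split=> // x; have [->|/pM/ltW//] := eqVneq x 0.
by rewrite mulmx0 mxE.
Qed.

Lemma psdD n (M N : 'M[R]_n) : psd M -> psd N -> psd (M + N).
Proof.
move=> [sM pM] [sN pN]; split; first by rewrite /Defs.symmetric linearD /= sM sN.
by move=> x; rewrite mulmxDr mulmxDl mxE addr_ge0.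
Qed.

Lemma psdZ n a (M : 'M[R]_n) : 0 <= a -> psd M -> psd (a *: M).
Proof.
move=> a0 [sM pM]; split; first by rewrite /Defs.symmetric linearZ /= sM.
by move=> x; rewrite -scalemxAr -scalemxAl mxE mulr_ge0.
Qed.

Lemma psd_congr m n (M : 'M[R]_n) (N : 'M[R]_(m, n)) : psd M -> psd (N *m M *m N^T).
Proof.
move=> [sM pM]; split; first by rewrite /Defs.symmetric !trmx_mul trmxK sM mulmxA.
by move=> x; have := pM (N^T *m x); rewrite trmx_mul trmxK !mulmxA.
Qed.

Lemma psd_congr_tr m n (M : 'M[R]_n) (N : 'M[R]_(n, m)) : psd M -> psd (N^T *m M *m N).
Proof. by move=> /(psd_congr m n _ N^T); rewrite trmxK. Qed.

Lemma psd_pdD n (M N : 'M[R]_n) : psd M -> pd N -> pd (M + N).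
Proof.
move=> [sM pM] [sN pN]; split; first by rewrite /Defs.symmetric linearD /= sM sN.
by move=> x x0; rewrite mulmxDr mulmxDl mxE ltr_wpDl// pN.
Qed.

Lemma pdZ n a (M : 'M[R]_n) : 0 < a -> pd M -> pd (a *: M).
Proof.
move=> a0 [sM pM]; split; first by rewrite /Defs.symmetric linearZ /= sM.
by move=> x x0; rewrite -scalemxAr -scalemxAl mxE mulr_gt0// pM.
Qed.

Lemma pd_unit n (M : 'M[R]_n) : pd M -> M \in unitmx.
Proof.
move=> [sM pM]; rewrite -row_free_unit; apply: inj_row_free => v vM.
apply/eqP/contraT => v0; have := pM v^T; rewrite trmx_eq0 trmxK vM mul0mx mxE ltxx.
by move=> /(_ v0).
Qed.

Lemma psd_ker n (M : 'M[R]_n) (x : 'cV[R]_n) : psd M -> (x^T *m M *m x) 0 0 = 0 -> M *m x = 0.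
Proof.
move=> pM x0; have [sM _] := pM.
have : cmx x^T *m cmx M = 0.
  apply: psdC_ker; first by rewrite cmx_adj sM.
    exact: psd_psdC.
  by rewrite cmx_adj trmxK -!cmxM mxE x0.
rewrite -cmxM -(map_mx0 (real_complex R)) => /cmx_inj /(congr1 trmx).
by rewrite trmx_mul trmxK sM trmx0.
Qed.

Lemma pd_convex n (M N : 'M[R]_n) t : 0 <= t <= 1 -> pd M -> pd N ->
  pd ((1 - t) *: M + t *: N).
Proof.
move=> /andP[t0 t1] pM pN; have [->|tn] := eqVneq t 0.
  by rewrite subr0 scale1r scale0r addr0.
apply: psd_pdD; last by apply: pdZ => //; rewrite lt_def tn.
by apply: psdZ; [rewrite subr_ge0|exact: pd_psd].
Qed.

Lemma quad_convex m n (Q : 'M[R]_m) (X Y : 'M[R]_(m, n)) t :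
  (1 - t) *: (X^T *m Q *m X) + t *: (Y^T *m Q *m Y)
    - ((1 - t) *: X + t *: Y)^T *m Q *m ((1 - t) *: X + t *: Y) =
  ((1 - t) * t) *: ((X - Y)^T *m Q *m (X - Y)).
Proof.
have -> : ((1 - t) *: X + t *: Y)^T = (1 - t) *: X^T + t *: Y^T.
  by rewrite linearD /= !linearZ.
have -> : (X - Y)^T = X^T - Y^T by rewrite linearB.
rewrite !mulmxDl !mulmxDr ?mulNmx ?mulmxN -!scalemxAl -!scalemxAr.
set a := X^T *m Q *m X; set b := X^T *m Q *m Y; set c := Y^T *m Q *m X; set d := Y^T *m Q *m Y.
by apply/matrixP => i j; rewrite !mxE; ring.
Qed.

(** With [Y = K X], [K X K^T] is the matrix perspective [Y X^-1 Y^T]. The identity exhibits its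
    convexity gap as a sum of congruences and avoids the inverse. *)
Lemma perspective_convex m n (X0 X1 X : 'M[R]_n) (K0 K1 K : 'M[R]_(m, n)) t :
  X0^T = X0 -> X1^T = X1 -> X = (1 - t) *: X0 + t *: X1 ->
  K *m X = (1 - t) *: (K0 *m X0) + t *: (K1 *m X1) ->
  (1 - t) *: (K0 *m X0 *m K0^T) + t *: (K1 *m X1 *m K1^T) - K *m X *m K^T =
  (1 - t) *: ((K0 - K) *m X0 *m (K0 - K)^T) + t *: ((K1 - K) *m X1 *m (K1 - K)^T).
Proof.
move=> s0 s1 XE KX.
have sX : X^T = X by rewrite XE linearD !linearZ /= s0 s1.
have KXt : X *m K^T = (1 - t) *: (X0 *m K0^T) + t *: (X1 *m K1^T).
  by rewrite -{1}sX -trmx_mul KX linearD !linearZ /= !trmx_mul s0 s1.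
have E1 : K *m X *m K^T = (1 - t) *: (K0 *m X0 *m K^T) + t *: (K1 *m X1 *m K^T).
  by rewrite KX mulmxDl -!scalemxAl.
have E2 : K *m X *m K^T = (1 - t) *: (K *m X0 *m K0^T) + t *: (K *m X1 *m K1^T).
  by rewrite -mulmxA KXt mulmxDr -!scalemxAr !mulmxA.
have E3 : K *m X *m K^T = (1 - t) *: (K *m X0 *m K^T) + t *: (K *m X1 *m K^T).
  by rewrite XE mulmxDr mulmxDl -!scalemxAr -!scalemxAl.
have -> : (K0 - K)^T = K0^T - K^T by rewrite linearB.
have -> : (K1 - K)^T = K1^T - K^T by rewrite linearB.
rewrite !mulmxDl !mulmxDr ?mulNmx ?mulmxN ?opprK ?mulNmx.
(* The term [- K X K^T] is written as two negative copies and one positive copy, each expanded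
   differently, to produce the cross and square terms. *)
transitivity ((1 - t) *: (K0 *m X0 *m K0^T) + t *: (K1 *m X1 *m K1^T)
  - K *m X *m K^T - K *m X *m K^T + K *m X *m K^T); first by rewrite addrNK.
rewrite {1}E1 {1}E2 {1}E3; apply/matrixP => i j.
by rewrite !(addmxE, oppmxE, scalemxE); ring.
Qed.

End PsdCalculus.

(** * Symmetry, definiteness and minimality of Riccati solutions *)

Section Riccati.
Variables (R : realType) (n : nat) (A W S : 'M[R]_n).
Hypotheses (sW : W^T = W) (pS : psd S).

Let sS : S^T = S := pS.1.

(** For the pair [X], [X^T] the second coefficient in [riccati_diff] is the transpose of the first,
    so both are stable. *)
Lemma riccati_sym (X : 'M[R]_n) : A *m X + X *m A^T + X *m S *m X + W = 0 ->
  hurwitz (A + X *m S) -> X^T = X.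
Proof.
move=> XE hX.
have XtE : A *m X^T + X^T *m A^T + X^T *m S *m X^T + W = 0.
  have := congr1 trmx XE; rewrite !linearD /= !trmx_mul trmx0 trmxK sS sW mulmxA => E.
  by rewrite [A *m X^T + _]addrC; exact: E.
apply/esym/eqP; rewrite -subr_eq0; apply/eqP.
apply: (sylvester_real _ _ _ _ _ _ hX _ (riccati_diff _ _ _ _ _ _ _ _ XE XtE)).
have -> : A^T + S *m X^T = (A + X *m S)^T by rewrite linearD /= trmx_mul sS.
exact: hurwitz_tr.
Qed.

(** The Lyapunov lemma gives semidefiniteness. On a kernel vector of [X] every term of the equation
    but [W] vanishes, and [W] is definite. *)
Lemma riccati_pd (X : 'M[R]_n) : hurwitz A -> pd W -> X^T = X ->
  A *m X + X *m A^T + X *m S *m X + W = 0 -> pd X.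
Proof.
move=> hA pW sX XE.
have NE : - (A *m X + X *m A^T) = X *m S *m X + W.
  by apply/eqP; rewrite eqr_oppLR -subr_eq0 opprK addrA XE.
have pX : psd X.
  apply: (lyapunov_real _ _ _ _ hA sX); rewrite NE; apply: psdD; last exact: pd_psd.
  by rewrite -{2}sX; apply: psd_congr.
split=> // x x0; rewrite lt_def pX.2 andbT; apply/eqP => xX.
have Xx := psd_ker _ _ _ _ pX xX.
have xX0 : x^T *m X = 0 by rewrite -sX -trmx_mul Xx trmx0.
have : x^T *m (A *m X + X *m A^T + X *m S *m X + W) *m x = 0 by rewrite XE mulmx0 mul0mx.
rewrite !mulmxDr !mulmxDl.
have -> : x^T *m (A *m X) *m x = 0 by rewrite -!mulmxA Xx !mulmx0.
have -> : x^T *m (X *m A^T) *m x = 0 by rewrite mulmxA xX0 !mul0mx.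
have -> : x^T *m (X *m S *m X) *m x = 0 by rewrite -!mulmxA Xx !mulmx0.
by rewrite !add0r => xW; have := pW.2 x x0; rewrite xW mxE ltxx.
Qed.

(** For the stable matrix [A + X S], the Lyapunov residual of [Z - X] is that of the inequality plus
    the nonnegative square [(Z - X) S (Z - X)]. *)
Lemma riccati_le (X Z : 'M[R]_n) : X^T = X -> Z^T = Z ->
  A *m X + X *m A^T + X *m S *m X + W = 0 -> hurwitz (A + X *m S) ->
  psd (- (A *m Z + Z *m A^T + Z *m S *m Z + W)) -> psd (Z - X).
Proof.
move=> sX sZ XE hX pZ.
have sD : (Z - X)^T = Z - X by rewrite linearD linearN /= sX sZ.
apply: (lyapunov_real _ _ _ _ hX sD).
have -> : - ((A + X *m S) *m (Z - X) + (Z - X) *m (A + X *m S)^T) =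
   - (A *m Z + Z *m A^T + Z *m S *m Z + W) + (Z - X) *m S *m (Z - X)^T.
  have -> : (A + X *m S)^T = A^T + S *m X by rewrite linearD /= trmx_mul sS sX.
  rewrite sD -[- (A *m Z + _ + _ + _)]addr0 -XE.
  rewrite !mulmxDl !mulmxDr ?mulNmx ?mulmxN ?mulNmx !mulmxA.
  by apply/matrixP => i j; rewrite !(addmxE, oppmxE); ring.
by apply: psdD => //; apply: psd_congr.
Qed.
End Riccati.

(** * Convexity of the mixed cost along interpolated gains *)

Section Jmix.
Variables (R : realType) (n m : nat).
Variables (A : 'M[R]_n) (B : 'M[R]_(n, m)) (Bw : 'M[R]_n).
Variables (Q2 : 'M[R]_n) (R2 : 'M[R]_m) (Qinf : 'M[R]_n) (Rinf : 'M[R]_m).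
Variables (Qinfh : 'M[R]_n) (Rinfh : 'M[R]_m) (beta : R).
Hypotheses (b0 : 0 < beta) (hQ : is_psd_sqrt Qinf Qinfh) (hR : is_psd_sqrt Rinf Rinfh).
Hypotheses (pQ2 : psd Q2) (pW : pd (Wmx Bw)) (pQ : pd Qinf) (pR2 : pd R2) (pR : pd Rinf).

Local Notation S K := (beta ^- 2 *: SK Qinf Rinf K).
Local Notation ricc K X := (AK A B K *m X + X *m (AK A B K)^T + X *m S K *m X + Wmx Bw).
Local Notation J := (Jmix A B Bw Q2 R2 Qinf Rinf beta).
Local Notation XX := (XK A B Bw Qinf Rinf beta).

Lemma SK_pd K : pd (S K).
Proof.
apply: pdZ; first by rewrite invr_gt0 exprn_gt0.
rewrite /SK addrC; apply: psd_pdD => //.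
exact/psd_congr_tr/pd_psd.
Qed.

Lemma stab_riccatiE K X : stab_riccati A B Bw Qinf Rinf beta K X <->
  ricc K X = 0 /\ hurwitz (AK A B K + X *m S K).
Proof. by rewrite /stab_riccati -!scalemxAr -scalemxAl. Qed.

Lemma Kbeta_riccati K : Kbeta A B Bw Qinfh Rinfh beta K ->
  [/\ ricc K (XX K) = 0, hurwitz (AK A B K + XX K *m S K), (XX K)^T = XX K & pd (XX K)].
Proof.
move=> [hA hb].
have CC : (col_mx Qinfh (Rinfh *m K))^T *m col_mx Qinfh (Rinfh *m K) = SK Qinf Rinf K.
  rewrite tr_col_mx mul_row_col trmx_mul hQ.1.1 hR.1.1 !mulmxA.
  by rewrite hQ.2 -(mulmxA K^T) hR.2.
have pS : pd (SK Qinf Rinf K).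
  have := pdZ _ _ _ _ (exprn_gt0 2 b0) (SK_pd K).
  by rewrite scalerA mulfV ?scale1r// expf_neq0// gt_eqF.
have [] := bounded_real _ _ _ _ _ Bw _ hA b0 hb _ pW; first by rewrite CC.
rewrite CC => X XE hX.
have [XXE XXh] : ricc K (XX K) = 0 /\ hurwitz (AK A B K + XX K *m S K).
  by apply/stab_riccatiE; apply: (@xgetPex _ 0); exists X.
have pS' := pd_psd _ _ _ (SK_pd K).
have sX := riccati_sym _ _ _ _ _ pW.1 pS' _ XXE XXh.
by split=> //; apply: (riccati_pd _ _ _ _ _ pS' _ hA pW sX XXE).
Qed.

Section Interpolation.
Variables (t : R) (X0 X1 : 'M[R]_n) (K0 K1 K : 'M[R]_(m, n)).
Hypotheses (t0 : 0 <= t) (t1 : 0 <= 1 - t) (p0 : psd X0) (p1 : psd X1).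
Let X := (1 - t) *: X0 + t *: X1.
Hypothesis KX : K *m X = (1 - t) *: (K0 *m X0) + t *: (K1 *m X1).

(** By cyclicity the cost is [tr (Q2 X) + tr (R2 K X K^T)]: a linear term and a perspective weighted
    by [R2]. *)
Lemma cost_convex :
  \tr ((Q2 + K^T *m R2 *m K) *m X) <=
  (1 - t) * \tr ((Q2 + K0^T *m R2 *m K0) *m X0) +
  t * \tr ((Q2 + K1^T *m R2 *m K1) *m X1).
Proof.
have trE L Z : \tr ((Q2 + L^T *m R2 *m L) *m Z) = \tr (Q2 *m Z) + \tr (R2 *m (L *m Z *m L^T)).
  by rewrite mulmxDl linearD /= -!mulmxA (mxtrace_mulC L^T) !mulmxA.
rewrite !trE -subr_ge0.
have := perspective_convex _ _ _ _ _ _ _ _ _ _ p0.1 p1.1 erefl KX; rewrite -/X => pE.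
set D := (X in 0 <= X).
have -> : D =
  \tr (R2 *m ((1 - t) *: (K0 *m X0 *m K0^T) + t *: (K1 *m X1 *m K1^T) - K *m X *m K^T)).
  rewrite mulmxBr mulmxDr -!scalemxAr raddfB /= mxtraceD !mxtraceZ.
  have hX : \tr (Q2 *m X) = (1 - t) * \tr (Q2 *m X0) + t * \tr (Q2 *m X1).
    by rewrite /X mulmxDr -!scalemxAr mxtraceD !mxtraceZ.
  rewrite /D hX; ring.
rewrite pE; apply: psd_tr_mul; first exact: pd_psd.
by apply: psdD; apply: psdZ => //; apply/psd_congr.
Qed.

(** In [(X, K X)] the residual is affine plus quadratic forms in [Qinf] and [Rinf]. It vanishes at
    both ends, so between them only the convexity gap of the forms remains. *)
Lemma riccati_convex : ricc K0 X0 = 0 -> ricc K1 X1 = 0 ->  psd (- ricc K X).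
Proof.
move=> E0 E1; have s0 := p0.1; have s1 := p1.1.
have sX : X^T = X by rewrite /X linearD !linearZ /= s0 s1.
have XSX L Z : Z^T = Z -> Z *m S L *m Z =
    beta ^- 2 *: (Z^T *m Qinf *m Z + (L *m Z)^T *m Rinf *m (L *m Z)).
  move=> sZ; rewrite -scalemxAr -scalemxAl /SK mulmxDr mulmxDl trmx_mul sZ.
  by rewrite !mulmxA.
have AX L Z : Z^T = Z -> AK A B L *m Z + Z *m (AK A B L)^T =
   A *m Z + Z *m A^T + (B *m (L *m Z) + (B *m (L *m Z))^T).
  move=> sZ; rewrite -{2}sZ -trmx_mul /AK mulmxDl linearD /= addrACA trmx_mul sZ.
  by rewrite !mulmxA.
have riccE L Z : Z^T = Z -> ricc L Z = A *m Z + Z *m A^T + (B *m (L *m Z) + (B *m (L *m Z))^T) +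
    beta ^- 2 *: (Z^T *m Qinf *m Z + (L *m Z)^T *m Rinf *m (L *m Z)) + Wmx Bw.
  by move=> sZ; rewrite (AX _ _ sZ) (XSX _ _ sZ).
have -> : - ricc K X = (beta ^- 2 * ((1 - t) * t)) *:
   ((X0 - X1)^T *m Qinf *m (X0 - X1)
    + (K0 *m X0 - K1 *m X1)^T *m Rinf *m (K0 *m X0 - K1 *m X1)).
  rewrite -scalerA (scalerDr ((1 - t) * t)) -!quad_convex -KX -/X.
  have -> : - ricc K X = (1 - t) *: ricc K0 X0 + t *: ricc K1 X1 - ricc K X.
    by rewrite E0 E1 !scaler0 !add0r.
  rewrite (riccE _ _ s0) (riccE _ _ s1) (riccE _ _ sX).
  have -> : A *m X = (1 - t) *: (A *m X0) + t *: (A *m X1).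
    by rewrite /X mulmxDr -!scalemxAr.
  have -> : X *m A^T = (1 - t) *: (X0 *m A^T) + t *: (X1 *m A^T).
    by rewrite /X mulmxDl -!scalemxAl.
  have -> : B *m (K *m X) = (1 - t) *: (B *m (K0 *m X0)) + t *: (B *m (K1 *m X1)).
    by rewrite KX mulmxDr -!scalemxAr.
  move: (X^T *m Qinf *m X) ((K *m X)^T *m Rinf *m (K *m X)) => q r.
  move: (X0^T *m Qinf *m X0) ((K0 *m X0)^T *m Rinf *m (K0 *m X0)) => q0 r0.
  move: (X1^T *m Qinf *m X1) ((K1 *m X1)^T *m Rinf *m (K1 *m X1)) => q1 r1.
  move: (A *m X0) (A *m X1) (X0 *m A^T) (X1 *m A^T) => a0 a1 a0' a1'.
  move: (B *m (K0 *m X0)) (B *m (K1 *m X1)) (Wmx Bw) => c0 c1 w.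
  by apply/matrixP => i j; rewrite !mxE; ring.
apply: psdZ; first by rewrite !mulr_ge0// invr_ge0 exprn_ge0// ltW.
by apply: psdD; apply/psd_congr_tr/pd_psd.
Qed.
End Interpolation.

(* If [K] has no stabilizing solution then [XK] takes its default value [0] and
   [J K = 0], which is below the nonnegative right-hand side. *)
Lemma Jmix_convex K0 K1 K t : 0 <= t <= 1 ->
  Kbeta A B Bw Qinfh Rinfh beta K0 -> Kbeta A B Bw Qinfh Rinfh beta K1 ->
  K *m ((1 - t) *: XX K0 + t *: XX K1) =
    (1 - t) *: (K0 *m XX K0) + t *: (K1 *m XX K1) ->
  J K <= (1 - t) * J K0 + t * J K1.
Proof.
move=> t01 /Kbeta_riccati[E0 _ s0 /pd_psd p0] /Kbeta_riccati[E1 _ s1 /pd_psd p1] KX.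
have /andP[t0 t1] := t01; have t1' : 0 <= 1 - t by rewrite subr_ge0.
have pP : psd (Q2 + K^T *m R2 *m K) by apply: psdD => //; exact/psd_congr_tr/pd_psd.
have pX := psdD _ _ _ _ (psdZ _ _ _ _ t1' p0) (psdZ _ _ _ _ t0 p1).
apply: le_trans (cost_convex _ _ _ _ _ _ t0 t1' p0 p1 KX).
have [[Z hZ]|no] := pselect (exists Z, stab_riccati A B Bw Qinf Rinf beta K Z); last first.
  have XK0 : XX K = 0 by apply: xgetPN => Z hZ; apply: no; exists Z.
  rewrite [leLHS]/Jmix XK0 mulmx0 mxtrace0.
  exact: (psd_tr_mul _ _ _ _ pP pX).
have [ZE hXX] : ricc K (XX K) = 0 /\ hurwitz (AK A B K + XX K *m S K).
  by apply/stab_riccatiE; apply: (@xgetPex _ 0); exists Z.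
have pS := pd_psd _ _ _ (SK_pd K).
have sZ := riccati_sym _ _ _ _ _ pW.1 pS _ ZE hXX.
rewrite [leLHS]/Jmix -subr_ge0 -raddfB -mulmxBr; apply: (psd_tr_mul _ _ _ _ pP).
apply: (riccati_le _ _ _ _ _ pS _ _ sZ pX.1 ZE hXX).
exact: (riccati_convex _ _ _ _ _ _ t0 t1' p0 p1 KX E0 E1).
Qed.

End Jmix.

(** * First-order optimality *)

Section MatrixNorm.
Variable R : realType.

Lemma mx_norm_ge_entry m n (M : 'M[R]_(m, n)) i j : `|M i j| <= `|M|.
Proof.
rewrite -[leRHS]/(mx_norm M) mx_normrE.
exact: (le_bigmax _ (fun ij => `|M ij.1 ij.2|) (i, j)).
Qed.

Lemma mx_norm_le m n (M : 'M[R]_(m, n)) c : 0 <= c -> (forall i j, `|M i j| <= c) -> `|M| <= c.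
Proof.
by move=> c0 Mc; rewrite -[leLHS]/(mx_norm M) mx_normrE; apply: bigmax_le => // -[i j] _; exact: Mc.
Qed.

Lemma mulmx_norm_le m n p (N : 'M[R]_(n, p)) : exists2 c, 0 <= c &
  forall M : 'M[R]_(m, n), `|M *m N| <= c * `|M|.
Proof.
have c0 : 0 <= \sum_k \sum_j `|N k j| by apply: sumr_ge0 => k _; apply: sumr_ge0.
exists (\sum_k \sum_j `|N k j|) => // M; apply: mx_norm_le; first by rewrite mulr_ge0.
move=> i j; rewrite mxE (le_trans (ler_norm_sum _ _ _))// mulr_suml.
apply: ler_sum => k _; rewrite normrM mulrC ler_pM ?mx_norm_ge_entry//.
by rewrite (bigD1 j)//= lerDl sumr_ge0.
Qed.

(* [K t *m X t] and [X t] are affine in [t]; solving for [D = K t - K 0] gives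
   [D = t E' - t D M'], hence [`|D| = O(t)] without inverting [X t] quantitatively. *)
Lemma ratio_lipschitz m n (X0 X1 : 'M[R]_n) (K0 K1 : 'M[R]_(m, n)) : X0 \in unitmx ->
  exists2 c, 0 <= c & exists2 d, 0 < d & forall t K, 0 <= t -> t <= d ->
    K *m ((1 - t) *: X0 + t *: X1) = (1 - t) *: (K0 *m X0) + t *: (K1 *m X1) ->
    `|K - K0| <= c * t.
Proof.
move=> uX0; pose E := (K1 - K0) *m X1 *m invmx X0.
pose N := (X1 - X0) *m invmx X0.
have [c c0 cN] := mulmx_norm_le m _ _ N.
have d0 : 0 < 2 * (c + 1) by lra.
exists (2 * `|E|); first by rewrite mulr_ge0.
(* For such [t], [t c] is at most one half, so the term [t c |K - K0|] is absorbed on the left at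
   the cost of the factor [2]. *)
exists (2 * (c + 1))^-1; first by rewrite invr_gt0.
move=> t K t0 td KX.
have DE : K - K0 = t *: E - t *: ((K - K0) *m N).
  have DX : (K - K0) *m X0 = t *: ((K1 - K0) *m X1) - t *: ((K - K0) *m (X1 - X0)).
    have : K *m X0 = (1 - t) *: (K0 *m X0) + t *: (K1 *m X1) + t *: (K *m X0) - t *: (K *m X1).
      rewrite -KX mulmxDr -!scalemxAr; move: (K *m X0) (K *m X1) => a b.
      by apply/matrixP => i j; rewrite !mxE; ring.
    rewrite !mulmxBl !mulmxBr => {1}->.
    move: (K *m X0) (K *m X1) (K0 *m X0) (K0 *m X1) (K1 *m X1) => a b d e f.
    by apply/matrixP => i j; rewrite !mxE; ring.
  by rewrite -[LHS](mulmxK uX0) DX mulmxBl -!scalemxAl /E /N !mulmxA.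
have h : `|K - K0| <= t * `|E| + t * (c * `|K - K0|).
  rewrite {1}DE (le_trans (ler_normB _ _))// !normrZ !(ger0_norm t0) lerD2l.
  by rewrite ler_wpM2l.
have tc : t * (2 * (c + 1)) <= 1 by rewrite -ler_pdivlMr// mul1r.
have : 0 <= `|K - K0| by [].
move: `|K - K0| `|E| h => x e h x0; nra.
Qed.

Lemma stationary_littleo m n (f : 'M[R]_(m, n) -> R) K : differentiable f K ->
  (forall V, 'd f K V = 0) -> forall eps, 0 < eps ->
  exists2 d, 0 < d & forall L, `|L - K| < d -> `|f L - f K| <= eps * `|L - K|.
Proof.
move=> /diff_locally /eqaddoP df f0 eps eps0.
have /nbhs_norm0P[d d0 hd] := df _ eps0.
exists d => // L Ld; have := hd _ Ld.
by rewrite /= !fctE /= f0 addr0 subrK.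
Qed.

End MatrixNorm.

Theorem theorem3 (R : realType) (n m : nat)
  (A : 'M[R]_n) (B : 'M[R]_(n, m)) (Bw : 'M[R]_n)
  (Q2 : 'M[R]_n) (R2 : 'M[R]_m) (Qinf : 'M[R]_n) (Rinf : 'M[R]_m)
  (Q2h Qinfh : 'M[R]_n) (Rinfh : 'M[R]_m) (beta : R) :
  0 < beta ->
  (* square roots *)
  is_psd_sqrt Q2 Q2h -> is_psd_sqrt Qinf Qinfh -> is_psd_sqrt Rinf Rinfh ->
  (* Assumption 1 *)
  stabilizable A B -> detectable Q2h A ->
  beta_star A B Bw Qinfh Rinfh < beta ->
  (* Assumption 2 *)
  psd Q2 -> pd (Wmx Bw) -> pd Qinf -> pd R2 -> pd Rinf ->
  forall K : 'M[R]_(m, n),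
    Kbeta A B Bw Qinfh Rinfh beta K ->
    differentiable (Jmix A B Bw Q2 R2 Qinf Rinf beta) K ->
    (forall V : 'M[R]_(m, n), 'd (Jmix A B Bw Q2 R2 Qinf Rinf beta) K V = 0) ->
    Jmix A B Bw Q2 R2 Qinf Rinf beta K =
      inf [set Jmix A B Bw Q2 R2 Qinf Rinf beta K' | K' in Kbeta A B Bw Qinfh Rinfh beta].
Proof.
move=> b0 _ hQ hR _ _ _ pQ2 pW pQ pR2 pR K kK dJ dJ0.
set J := Jmix A B Bw Q2 R2 Qinf Rinf beta in dJ dJ0 *.
set KB := Kbeta A B Bw Qinfh Rinfh beta in kK *.
suff Jmin K' : KB K' -> J K <= J K'.
  have lb : lbound [set J K' | K' in KB] (J K) by move=> _ [K' hK' <-]; exact: Jmin.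
  apply/eqP; rewrite eq_le; apply/andP; split.
    by apply: lb_le_inf lb; exists (J K), K.
  by apply: ge_inf; [exists (J K) | exists K].
move=> kK'; rewrite leNgt; apply/negP => JK'.
have [_ _ _ p0] := Kbeta_riccati _ _ _ A B Bw Qinf Rinf Qinfh Rinfh beta b0 hQ hR pW pQ pR K kK.
have [_ _ _ p1] := Kbeta_riccati _ _ _ A B Bw Qinf Rinf Qinfh Rinfh beta b0 hQ hR pW pQ pR K' kK'.
have Jconv := Jmix_convex _ _ _ A B Bw Q2 R2 Qinf Rinf Qinfh Rinfh beta
  b0 hQ hR pQ2 pW pQ pR2 pR K K' _ _ _ kK kK'.
set X0 := XK A B Bw Qinf Rinf beta K in p0 Jconv.
set X1 := XK A B Bw Qinf Rinf beta K' in p1 Jconv.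
have [c c0 [d d0 lip]] := ratio_lipschitz _ _ _ X0 X1 K K' (pd_unit _ _ _ p0).
rewrite -/J in Jconv; clearbody J X0 X1.
have [g gE] : exists g, g = J K - J K' by exists (J K - J K').
have g0 : 0 < g by rewrite gE subr_gt0.
have c1 : 0 < 2 * (c + 1) by lra.
(* Convexity gives [J L <= J K - t g]. With [|L - K| <= c t], this tolerance limits the first-order
   error to [t g / 2], a contradiction; [c + 1] covers [c = 0]. *)
have [e e0 he] := stationary_littleo _ _ _ _ K dJ dJ0 (g / (2 * (c + 1))) (divr_gt0 g0 c1).
(* The three bounds keep the combination convex, the Lipschitz estimate applicable, and
   [c t < e]. *)
pose t := Num.min 1 (Num.min d (e / (2 * (c + 1)))).
have t0 : 0 < t by rewrite !lt_min ltr01 d0 divr_gt0.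
have [t1 td te] : [/\ t <= 1, t <= d & t <= e / (2 * (c + 1))].
  by split; rewrite /t !ge_min lexx ?orbT.
have uX := pd_unit _ _ _ (pd_convex _ _ _ _ _ (introT andP (conj (ltW t0) t1)) p0 p1).
set X := (1 - t) *: X0 + t *: X1 in uX.
pose L := ((1 - t) *: (K *m X0) + t *: (K' *m X1)) *m invmx X.
have LX : L *m X = (1 - t) *: (K *m X0) + t *: (K' *m X1) by rewrite mulmxKV.
have LK := lip t L (ltW t0) td LX.
have JL := Jconv L t (introT andP (conj (ltW t0) t1)) LX.
have Le : `|L - K| < e.
  apply: (le_lt_trans LK); move: te; rewrite ler_pdivlMr// => te; nra.
have := he L Le; rewrite ler_norml => /andP[JL' _].
have gc : g / (2 * (c + 1)) * `|L - K| <= t * g / 2.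
  rewrite mulrAC ler_pdivrMr//; have : 0 <= `|L - K| by []; move: LK; move: `|L - K| => x; nra.
rewrite gE in g0 gc JL'.
move: (J L) (J K) (J K') JL JL' g0 gc => jl j j' JL JL' g0 gc; nra.
Qed.
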